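(* Let $\mathcal{A}$ be an abelian category with subcategories $\mathcal{X},\mathcal{Y},\mathcal{W},\mathcal{V}$ such that $\mathcal{W}\subseteq\mathcal{X}$ and $\mathcal{V}\subseteq\mathcal{Y}$. Assume that $\mathcal{X}$ and $\mathcal{Y}$ are closed under extensions, $\mathcal{W}$ is an injective cogenerator for $\mathcal{X}$, $\mathcal{V}$ is a projective generator for $\mathcal{Y}$, $\mathcal{W}\perp\mathcal{Y}$ and $\mathcal{X}\perp\mathcal{V}$. Assume further that $\operatorname{Ext}^{n}_{\mathcal{W}\mathcal{A}}(T,V)=0$ and $\operatorname{Ext}^{n}_{\mathcal{A}\mathcal{V}}(W,U)=0$ for all $n\geq 1$, all objects $V\in\mathcal{V}$, $W\in\mathcal{W}$, and all objects $T,U$ of $\mathcal{A}$ with $\mathcal{W}\text{-}\operatorname{pd}(T)<\infty$ and $\mathcal{V}\text{-}\operatorname{id}(U)<\infty$. If $M$ and $N$ are objects of $\mathcal{A}$ such that $\mathcal{X}\text{-}\operatorname{pd}(M)<\infty$ and $\mathcal{Y}\text{-}\operatorname{id}(N)<\infty$, then there are isomorphisms $\operatorname{Ext}^n_{\mathcal{X}\mathcal{A}}(M,N)\cong\operatorname{Ext}^n_{\mathcal{A}\mathcal{Y}}(M,N)$ for all $n\in\mathbb{Z}$.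
   Context: ''Subcategory'' means full, additive subcategory closed under isomorphisms. For classes $\mathcal{C},\mathcal{D}$ of objects of $\mathcal{A}$, $\mathcal{C}\perp\mathcal{D}$ means $\operatorname{Ext}^i_{\mathcal{A}}(C,D)=0$ for all $i\geq1$, $C\in\mathcal{C}$, $D\in\mathcal{D}$. $\mathcal{W}$ is a cogenerator for $\mathcal{X}$ if $\mathcal{W}\subseteq\mathcal{X}$ and for each $X\in\mathcal{X}$ there is an exact sequence $0\to X\to W\to X'\to0$ with $W\in\mathcal{W}$, $X'\in\mathcal{X}$; it is an injective cogenerator if moreover $\mathcal{X}\perp\mathcal{W}$. $\mathcal{V}$ is a generator for $\mathcal{Y}$ if $\mathcal{V}\subseteq\mathcal{Y}$ and for each $Y\in\mathcal{Y}$ there is an exact sequence $0\to Y'\to V\to Y\to 0$ with $V\in\mathcal{V}$, $Y'\in\mathcal{Y}$; it is a projective generator if moreover $\mathcal{V}\perp\mathcal{Y}$. Complexes are indexed homologically. For a subcategory $\mathcal{C}$, a $\mathcal{C}$-resolution of $M$ is a complex $C$ of objects of $\mathcal{C}$ with $C_n=0$ for $n<0$, $\operatorname{H}_n(C)=0$ for $n>0$ and $\operatorname{H}_0(C)\cong M$; its augmented resolution is the exact sequence $C^+=\cdots\to C_1\to C_0\to M\to0$. It is proper if $\operatorname{Hom}_{\mathcal{A}}(C',C^+)$ is exact for every $C'\in\mathcal{C}$. $\mathcal{C}\text{-}\operatorname{pd}(M)=\inf\{\sup\{n\ge0\mid C_n\neq0\}\mid C\text{ a }\mathcal{C}\text{-resolution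 of }M\}$. Dually, a $\mathcal{C}$-coresolution of $N$ is a complex $C$ of objects of $\mathcal{C}$ with $C_n=0$ for $n>0$, $\operatorname{H}_n(C)=0$ for $n<0$ and $\operatorname{H}_0(C)\cong N$, with augmented coresolution ${}^+C=0\to N\to C_0\to C_{-1}\to\cdots$; it is proper if $\operatorname{Hom}_{\mathcal{A}}({}^+C,C')$ is exact for every $C'\in\mathcal{C}$; $\mathcal{C}\text{-}\operatorname{id}(N)$ is the minimal length of a $\mathcal{C}$-coresolution of $N$. If $M$ has a proper $\mathcal{C}$-resolution $C\to M$, then $\operatorname{Ext}^n_{\mathcal{C}\mathcal{A}}(M,N)=\operatorname{H}_{-n}(\operatorname{Hom}_{\mathcal{A}}(C,N))$. If $N$ has a proper $\mathcal{C}$-coresolution $N\to C$, then $\operatorname{Ext}^n_{\mathcal{A}\mathcal{C}}(M,N)=\operatorname{H}_{-n}(\operatorname{Hom}_{\mathcal{A}}(M,C))$. These are independent of choices; all (co)resolutions needed here exist under the stated hypotheses. *)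

(* Defs.v *)
From HB Require Import structures.
From Stdlib Require Import Relation_Operators.
From mathcomp Require Import all_boot all_order all_algebra.
From mathcomp Require Import boolp.

Set Implicit Arguments.
Unset Strict Implicit.
Unset Printing Implicit Defensive.

Import Order.TTheory GRing.Theory Num.Theory.
Local Open Scope ring_scope.

Declare Scope cat_scope.
Delimit Scope cat_scope with cat.

Record preaddCat := PreaddCat {
  ob :> Type;
  hom : ob -> ob -> zmodType;
  idm : forall a, hom a a;
  compm : forall a b c, hom b c -> hom a b -> hom a c;
  comp1m : forall a b (f : hom a b), compm (idm b) f = f;
  compm1 : forall a b (f : hom a b), compm f (idm a) = f;
  compmA : forall a b c d (h : hom c d) (g : hom b c) (f : hom a b),
    compm h (compm g f) = compm (compm h g) f;
  compmDl : forall a b c (g g' : hom b c) (f : hom a b),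
    compm (g + g') f = compm g f + compm g' f;
  compmDr : forall a b c (g : hom b c) (f f' : hom a b),
    compm g (f + f') = compm g f + compm g f' }.

Arguments hom {A} a b : rename.
Arguments idm {A} a : rename.
Arguments compm {A a b c} g f : rename.

Notation "g \o f" := (compm g f) : cat_scope.
Local Open Scope cat_scope.

Section Preadditive.
Variable A : preaddCat.
Implicit Types a b c z : A.

Definition is_zero z :=
  (forall a (f : hom a z), f = 0) /\ (forall a (f : hom z a), f = 0).

Definition mono a b (f : hom a b) :=
  forall c (g h : hom c a), f \o g = f \o h -> g = h.

Definition epi a b (f : hom a b) :=
  forall c (g h : hom b c), g \o f = h \o f -> g = h.

Definition iso a b :=
  exists (f : hom a b) (g : hom b a), g \o f = idm a /\ f \o g = idm b.

Definition is_biprod a b s (i1 : hom a s) (i2 : hom b s)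
    (p1 : hom s a) (p2 : hom s b) :=
  [/\ p1 \o i1 = idm a, p2 \o i2 = idm b, p1 \o i2 = 0, p2 \o i1 = 0
    & (i1 \o p1) + (i2 \o p2) = idm s].

Definition is_kernel a b (f : hom a b) k (i : hom k a) :=
  f \o i = 0 /\
  forall c (g : hom c a), f \o g = 0 -> exists! u : hom c k, i \o u = g.

Definition is_cokernel a b (f : hom a b) q (p : hom b q) :=
  p \o f = 0 /\
  forall c (g : hom b c), g \o f = 0 -> exists! u : hom q c, u \o p = g.

Definition is_ses a b c (i : hom a b) (p : hom b c) :=
  is_kernel p i /\ is_cokernel i p.

Lemma compm0 a b c (g : hom b c) : g \o (0 : hom a b) = 0.
Proof. by apply: (addrI (g \o 0)); rewrite -compmDr !addr0. Qed.

Lemma comp0m a b c (f : hom a b) : (0 : hom b c) \o f = 0.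
Proof. by apply: (addrI (0 \o f)); rewrite -compmDl !addr0. Qed.

End Preadditive.

Record abelianCat := AbelianCat {
  acat :> preaddCat;
  zero_ob : acat;
  zero_obP : is_zero zero_ob;
  has_biprod : forall a b : acat, exists s (i1 : hom a s) (i2 : hom b s)
    (p1 : hom s a) (p2 : hom s b), is_biprod i1 i2 p1 p2;
  has_kernel : forall (a b : acat) (f : hom a b),
    exists k (i : hom k a), is_kernel f i;
  has_cokernel : forall (a b : acat) (f : hom a b),
    exists q (p : hom b q), is_cokernel f p;
  mono_normal : forall (a b : acat) (f : hom a b), mono f ->
    exists c (g : hom b c), is_kernel g f;
  epi_normal : forall (a b : acat) (f : hom a b), epi f ->
    exists c (g : hom c a), is_cokernel g f }.

Arguments zero_ob : clear implicits.

Section YonedaExt.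
Variable A : abelianCat.

Record ses (D C : A) := Ses {
  ses_mid : A;
  ses_inj : hom D ses_mid;
  ses_surj : hom ses_mid C;
  sesP : is_ses ses_inj ses_surj }.

(* [yext n D C] is the type of (n+1)-fold extensions
   0 -> D -> E_n -> ... -> E_0 -> C -> 0, each given as the splice of its
   short exact sequences 0 -> D -> E_n -> J -> 0, etc. *)
Fixpoint yext (n : nat) (D C : A) : Type :=
  match n with
  | 0 => ses D C
  | m.+1 => {J : A & (ses D J * yext m J C)%type}
  end.

(* Existence of a morphism of exact sequences that is [f] on the left end and
   the identity on the right end. *)
Fixpoint yext_map (n : nat) (C : A) :
    forall D D' : A, hom D D' -> yext n D C -> yext n D' C -> Prop :=
  match n return forall D D' : A, hom D D' -> yext n D C -> yext n D' C -> Prop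
  with
  | 0 => fun D D' f E E' =>
      exists g : hom (ses_mid E) (ses_mid E'),
        g \o ses_inj E = ses_inj E' \o f /\ ses_surj E' \o g = ses_surj E
  | m.+1 => fun D D' f E E' =>
      let: existT J (s, t) := E in
      let: existT J' (s', t') := E' in
      exists (g : hom (ses_mid s) (ses_mid s')) (h : hom J J'),
        [/\ g \o ses_inj s = ses_inj s' \o f,
            ses_surj s' \o g = h \o ses_surj s
          & yext_map h t t']
  end.

Definition yext_equiv n (D C : A) : yext n D C -> yext n D C -> Prop :=
  clos_refl_sym_trans _ (yext_map (idm D)).

(* Ext^(n+1)(C, D) is the set of classes of [yext_equiv], with the Baer sum;
   this group vanishes iff there is only one class. *)
Definition ext_zero n (C D : A) :=
  forall E E' : yext n D C, yext_equiv E E'.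

End YonedaExt.

Section Classes.
Variable A : abelianCat.
Implicit Types P Q : A -> Prop.

Record subcategory P : Prop := Subcategory {
  sub_iso : forall a b, iso a b -> P a -> P b;
  sub_zero : P (zero_ob A);
  sub_biprod : forall a b s (i1 : hom a s) (i2 : hom b s)
      (p1 : hom s a) (p2 : hom s b),
    is_biprod i1 i2 p1 p2 -> P a -> P b -> P s }.

Definition subclass P Q := forall a, P a -> Q a.

Definition ext_closed P :=
  forall a b c (i : hom a b) (p : hom b c), is_ses i p -> P a -> P c -> P b.

Definition perp P Q := forall C D, P C -> Q D -> forall n, ext_zero n C D.

Definition cogenerator W X :=
  subclass W X /\
  forall a, X a -> exists w a' (i : hom a w) (p : hom w a'),
    [/\ is_ses i p, W w & X a'].

Definition injective_cogenerator W X := cogenerator W X /\ perp X W.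

Definition generator V Y :=
  subclass V Y /\
  forall a, Y a -> exists a' v (i : hom a' v) (p : hom v a),
    [/\ is_ses i p, V v & Y a'].

Definition projective_generator V Y := generator V Y /\ perp V Y.

End Classes.

(* The differential is indexed by pairs of degrees and vanishes unless it lowers
   the degree by one, so that no transport between [n - 1 + 1] and [n] is
   needed. *)
Record cplx (A : preaddCat) := Cplx {
  cob :> int -> A;
  diff : forall i j, hom (cob i) (cob j);
  diff_shape : forall i j, i != j + 1 -> diff i j = 0;
  diffK : forall i j k, diff j k \o diff i j = 0 }.

Arguments diff {A} C i j : rename.

(* [k] is the kernel of the outgoing differential at [n], and
   [p] the cokernel of the factorisation through [k] of the incoming one. *)
Definition is_homology (A : preaddCat) (C : cplx A) (n : int)
    (K H : A) (k : hom K (C n)) (p : hom K H) :=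
  is_kernel (diff C n (n - 1)) k /\
  exists u : hom (C (n + 1)) K,
    k \o u = diff C (n + 1) n /\ is_cokernel u p.

Definition homology_zero (A : preaddCat) (C : cplx A) (n : int) :=
  exists (K H : A) (k : hom K (C n)) (p : hom K H),
    is_homology k p /\ is_zero H.

Record zcplx := ZCplx {
  zob :> int -> zmodType;
  zdiff : forall i j, {additive zob i -> zob j};
  zdiff_shape : forall i j, i != j + 1 -> forall x, zdiff i j x = 0;
  zdiffK : forall i j k x, zdiff j k (zdiff i j x) = 0 }.

Arguments zdiff C i j : rename.

Section ZHomology.
Variables (U V W : zmodType) (f : {additive U -> V}) (g : {additive V -> W}).

Definition ker_pred : {pred V} := [pred x | g x == 0].

Fact ker_pred_zmod : zmod_closed ker_pred.
Proof.
split=> [|x y]; rewrite !inE ?raddf0 // => /eqP gx /eqP gy.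
by rewrite raddfB gx gy subr0.
Qed.
HB.instance Definition _ := GRing.isZmodClosed.Build V ker_pred ker_pred_zmod.

Record zcycle := ZCycle { zcycle_val : V; _ : zcycle_val \in ker_pred }.

HB.instance Definition _ := [isSub for zcycle_val].
HB.instance Definition _ := [Choice of zcycle by <:].
HB.instance Definition _ := [SubChoice_isSubZmodule of zcycle by <:].

Definition bnd_pred : {pred zcycle} :=
  [pred z | `[< exists x, f x = zcycle_val z >]].

Fact bnd_pred_zmod : zmod_closed bnd_pred.
Proof.
split=> [|x y]; rewrite !inE; first by apply/asboolP; exists 0; rewrite !raddf0.
move=> /asboolP[u fu] /asboolP[v fv]; apply/asboolP; exists (u - v).
by rewrite !raddfB fu fv.
Qed.
HB.instance Definition _ := GRing.isZmodClosed.Build zcycle bnd_pred bnd_pred_zmod.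

Definition subquot : zmodType := Quotient.quot bnd_pred.

End ZHomology.

Definition zhomology (C : zcplx) (n : int) : zmodType :=
  subquot (zdiff C (n + 1) n) (zdiff C n (n - 1)).

Definition zmod_zero (U : zmodType) := forall x : U, x = 0.

Definition zmod_iso (U V : zmodType) := exists f : {additive U -> V}, bijective f.

Definition zexact (C : zcplx) := forall n, zmod_zero (zhomology C n).

Section Hom.
Variable A : preaddCat.

Section Additive.
Variables (a b c : A).

Definition postc (g : hom b c) (f : hom a b) : hom a c := g \o f.
Definition prec (f : hom a b) (g : hom b c) : hom a c := g \o f.

Fact postc_additive g : zmod_morphism (postc g).
Proof.
move=> x y; apply: (addIr (postc g y)).
by rewrite subrK /postc -compmDr subrK.
Qed.
HB.instance Definition _ g :=
  GRing.isZmodMorphism.Build _ _ (postc g) (postc_additive g).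

Fact prec_additive f : zmod_morphism (prec f).
Proof.
move=> x y; apply: (addIr (prec f y)).
by rewrite subrK /prec -compmDl subrK.
Qed.
HB.instance Definition _ f :=
  GRing.isZmodMorphism.Build _ _ (prec f) (prec_additive f).
End Additive.

Section HomTo.
Variables (M : A) (C : cplx A).

Definition hom_to_diff i j : {additive hom M (C i) -> hom M (C j)} :=
  postc (diff C i j).

Fact hom_to_shape i j : i != j + 1 -> forall x, hom_to_diff i j x = 0.
Proof. by move=> ij x; rewrite /= /postc diff_shape // comp0m. Qed.

Fact hom_toK i j k x : hom_to_diff j k (hom_to_diff i j x) = 0.
Proof. by rewrite /= /postc compmA diffK comp0m. Qed.

Definition hom_to : zcplx := ZCplx hom_to_shape hom_toK.
End HomTo.

(* Hom(C, N), with Hom(C_n, N) in degree -n; the usual signs are omitted, which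
   changes neither kernels nor images. *)
Section HomFrom.
Variables (C : cplx A) (N : A).

Definition hom_from_diff i j : {additive hom (C (- i)) N -> hom (C (- j)) N} :=
  prec (diff C (- j) (- i)).

Fact hom_from_shape i j : i != j + 1 -> forall x, hom_from_diff i j x = 0.
Proof.
move=> ij x; rewrite /= /prec diff_shape ?compm0 //.
by apply: contra ij => /eqP e; rewrite -(opprK j) e opprD opprK addrNK.
Qed.

Fact hom_fromK i j k x : hom_from_diff j k (hom_from_diff i j x) = 0.
Proof. by rewrite /= /prec -compmA diffK compm0. Qed.

Definition hom_from : zcplx := @ZCplx _ hom_from_diff hom_from_shape hom_fromK.
End HomFrom.

End Hom.

Section Resolutions.
Variable A : abelianCat.
Implicit Types P : A -> Prop.

(* The augmentation is the composite C_0 <~- Z_0 -> H_0(C) ~ M: it restricts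
   along the (invertible) kernel [k] of C_0 -> C_(-1) to a homology
   projection. *)
Record resolution P (M : A) := Resolution {
  res :> cplx A;
  resP : forall n, P (res n);
  res_neg : forall n : int, n < 0 -> is_zero (res n);
  res_acyclic : forall n : int, 0 < n -> homology_zero res n;
  res_aug : hom (res 0) M;
  res_augP : exists K (k : hom K (res 0)) (p : hom K M),
    is_homology k p /\ res_aug \o k = p }.

(* Dually, the coaugmentation is N ~ H_0(C) = Z_0 -> C_0. *)
Record coresolution P (N : A) := Coresolution {
  cores :> cplx A;
  coresP : forall n, P (cores n);
  cores_pos : forall n : int, 0 < n -> is_zero (cores n);
  cores_acyclic : forall n : int, n < 0 -> homology_zero cores n;
  cores_aug : hom N (cores 0);
  cores_augP : exists K (k : hom K (cores 0)) (p : hom K N),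
    is_homology k p /\ cores_aug \o p = k }.

Lemma res_aug_diff P M (C : resolution P M) : res_aug C \o diff C 1 0 = 0.
Proof.
case: (res_augP C) => K [k [p [[_ [u [ku [pu _]]]] ep]]].
have -> : diff C 1 0 = k \o u by rewrite ku.
by rewrite compmA ep.
Qed.

Lemma cores_diff_aug P N (C : coresolution P N) :
  diff C 0 (-1) \o cores_aug C = 0.
Proof.
case: (cores_augP C) => K [k [p [[kk [u [_ cu]]] ip]]].
have pe : epi p.
  move=> c g h gh; have e : (h \o p) \o u = 0 by rewrite -compmA cu.1 compm0.
  by have [v [_ vu]] := cu.2 _ _ e; rewrite -(vu _ gh) -(vu h).
apply: pe; rewrite comp0m -compmA ip.
exact: kk.1.
Qed.

(* ... -> C_1 -> C_0 -> M -> 0, with M in degree -1 *)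
Section Augmented.
Variables (P : A -> Prop) (M : A) (C : resolution P M).

Definition aug_ob (n : int) : A :=
  match n with
  | Posz m => C (Posz m)
  | Negz 0 => M
  | Negz _ => zero_ob A
  end.

Definition aug_diff (i j : int) : hom (aug_ob i) (aug_ob j) :=
  match j, i with
  | Posz j, Posz i => diff C (Posz i) (Posz j)
  | Negz 0, Posz 0 => res_aug C
  | _, _ => 0
  end.

Fact aug_diff_shape i j : i != j + 1 -> aug_diff i j = 0.
Proof.
by case: i j => [[|i]|i] [j|[|j]] //=; apply: diff_shape.
Qed.

Fact aug_diffK i j k : aug_diff j k \o aug_diff i j = 0.
Proof.
case: i j k => [[|[|i]]|[|i]] [[|j]|[|j]] [k|[|k]] //=;
  rewrite ?(comp0m, compm0, diffK) //.
- by rewrite diff_shape ?compm0.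
- exact: res_aug_diff.
by rewrite diff_shape ?compm0.
Qed.

Definition aug : cplx A := Cplx aug_diff_shape aug_diffK.
End Augmented.

(* 0 -> N -> C_0 -> C_(-1) -> ..., with N in degree 1 *)
Section Coaugmented.
Variables (P : A -> Prop) (N : A) (C : coresolution P N).

Definition coaug_ob (n : int) : A :=
  match n with
  | Posz 0 => C 0
  | Posz 1 => N
  | Posz _ => zero_ob A
  | Negz m => C (Negz m)
  end.

Definition coaug_diff (i j : int) : hom (coaug_ob i) (coaug_ob j) :=
  match i, j with
  | Posz 1, Posz 0 => cores_aug C
  | Posz 0, Posz 0 => diff C 0 0
  | Posz 0, Negz j => diff C 0 (Negz j)
  | Negz i, Posz 0 => diff C (Negz i) 0
  | Negz i, Negz j => diff C (Negz i) (Negz j)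
  | _, _ => 0
  end.

Fact coaug_diff_shape i j : i != j + 1 -> coaug_diff i j = 0.
Proof.
by case: i j => [[|[|i]]|i] [[|[|j]]|j] //= ij; apply: diff_shape.
Qed.

Fact coaug_diffK i j k : coaug_diff j k \o coaug_diff i j = 0.
Proof.
case: i j k => [[|[|i]]|i] [[|[|j]]|j] [[|[|k]]|k] //=;
  rewrite ?(comp0m, compm0, diffK) //.
- by rewrite diff_shape // comp0m.
case: k => [|k]; first exact: cores_diff_aug.
by rewrite diff_shape ?comp0m.
Qed.

Definition coaug : cplx A := Cplx coaug_diff_shape coaug_diffK.
End Coaugmented.

Record proper_resolution P (M : A) := ProperResolution {
  pres :> resolution P M;
  presP : forall C', P C' -> zexact (hom_to C' (aug pres)) }.

Record proper_coresolution P (N : A) := ProperCoresolution {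
  pcores :> coresolution P N;
  pcoresP : forall C', P C' -> zexact (hom_from (coaug pcores) C') }.

(* The bound says that sup {n | C_n <> 0} <= b, so that [pd_finite P M] unfolds
   P-pd(M) = inf {sup {n | C_n <> 0}} < oo; likewise for [id_finite]. *)
Definition pd_le P (M : A) (b : nat) :=
  exists C : resolution P M, forall n : int, b%:Z < n -> is_zero (C n).

Definition id_le P (N : A) (b : nat) :=
  exists C : coresolution P N, forall n : int, n < - b%:Z -> is_zero (C n).

Definition pd_finite P M := exists b, pd_le P M b.
Definition id_finite P N := exists b, id_le P N b.

Definition relExtl P (M : A) (C : proper_resolution P M) (N : A) (n : int) :
  zmodType := zhomology (hom_from C N) (- n).

Definition relExtr P (M N : A) (C : proper_coresolution P N) (n : int) :
  zmodType := zhomology (hom_to M C) (- n).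

End Resolutions.

Arguments relExtl {A P M} C N n.
Arguments relExtr {A P} M {N} C n.

(* Main.v *)
(** Let C -> M be a proper X-resolution and N -> D a proper Y-coresolution. The
    bicomplex Hom(C_i, D_j) compares Hom(C, N) with Hom(M, D) as soon as
    Hom(C+, Y') is exact for all Y' in Y and, dually, Hom(X', +D) is exact for all
    X' in X; the second claim is the first one in the opposite category.

    For the first claim, Auslander-Buchweitz approximation gives a short exact
    sequence 0 -> K -> X_0 -> M -> 0 with K of finite W-dimension. Embedding X_0
    in an object W_0 of W yields 0 -> K -> W_0 -> Q -> 0 with Q of finite
    W-dimension, so maps K -> Y' extend to W_0, hence to X_0, provided
    Ext^1(Q, Y') = 0. This vanishing is proved by induction on the dimension of Q:
    a map from a syzygy to Y' lifts along V' -> Y', with V' in V, and then extends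
    by the hypothesis on Ext_WA(-, V'). Schanuel's argument carries the extension
    property over to arbitrary proper resolutions. Properness of the W-resolutions
    needs Ext^1(X', T) = 0 for T of finite W-dimension, which is dimension shifting
    in Yoneda Ext. *)

From HB Require Import structures.
From Stdlib Require Import Relation_Operators.
Require Import Defs.
From mathcomp Require Import all_boot all_order all_algebra.
From mathcomp Require Import boolp.
Import Defs.

Set Implicit Arguments.
Unset Strict Implicit.
Unset Printing Implicit Defensive.

Import Order.TTheory GRing.Theory Num.Theory.
Local Open Scope ring_scope.
Local Open Scope quotient_scope.
Local Open Scope cat_scope.

(** * Abelian categories *)

Section PreadditiveLemmas.
Variable A : preaddCat.
Implicit Types a b c z : A.

(** No supply of projectives or injectives is available, so dimension shifting works with Yoneda
    classes directly: the one piece of the long exact sequence that it needs is extracted from an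
    invariant of classes of extensions. Duality means instantiation at [opp A]; the vanishing of
    Yoneda Ext takes real work there, because a splice is built from its left end and has to be
    reversed. The syzygies of an arbitrary proper [X]-resolution of [M] are not known to have finite
    [X]-dimension, since [X] is not assumed closed under direct summands. Being a retract of an
    object of finite [X]-dimension is the property that survives from one syzygy to the next. The
    two cohomology groups are compared by additive correspondences along an antidiagonal of the
    bicomplex, so that no total complex is formed and no map has to be chosen before the end. *)

Lemma compmN a b c (g : hom b c) (f : hom a b) : g \o (- f) = - (g \o f).
Proof. by apply: (addrI (g \o f)); rewrite -compmDr !subrr compm0. Qed.

Lemma compNm a b c (g : hom b c) (f : hom a b) : (- g) \o f = - (g \o f).
Proof. by apply: (addrI (g \o f)); rewrite -compmDl !subrr comp0m. Qed.

Lemma compmBr a b c (g : hom b c) (f f' : hom a b) :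
  g \o (f - f') = (g \o f) - (g \o f').
Proof. by rewrite compmDr compmN. Qed.

Lemma compmBl a b c (g g' : hom b c) (f : hom a b) :
  (g - g') \o f = (g \o f) - (g' \o f).
Proof. by rewrite compmDl compNm. Qed.

Lemma epi0P a b (f : hom a b) :
  epi f <-> (forall c (g : hom b c), g \o f = 0 -> g = 0).
Proof.
split=> [ef c g gf|ef c g h gh]; first by apply: ef; rewrite gf comp0m.
by apply/eqP; rewrite -subr_eq0; apply/eqP/ef; rewrite compmBl gh subrr.
Qed.

Lemma mono0P a b (f : hom a b) :
  mono f <-> (forall c (g : hom c a), f \o g = 0 -> g = 0).
Proof.
split=> [mf c g fg|mf c g h gh]; first by apply: mf; rewrite fg compm0.
by apply/eqP; rewrite -subr_eq0; apply/eqP/mf; rewrite compmBr gh subrr.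
Qed.

Lemma epi_comp a b c (g : hom b c) (f : hom a b) :
  epi g -> epi f -> epi (g \o f).
Proof. by move=> eg ef d x y; rewrite !compmA => /ef/eg. Qed.

Lemma mono_comp a b c (g : hom b c) (f : hom a b) :
  mono g -> mono f -> mono (g \o f).
Proof. by move=> mg mf d x y; rewrite -!compmA => /mg/mf. Qed.

Lemma epi_compl a b c (g : hom b c) (f : hom a b) : epi (g \o f) -> epi g.
Proof. by move=> e d x y xy; apply: e; rewrite !compmA xy. Qed.

Lemma mono_compr a b c (g : hom b c) (f : hom a b) : mono (g \o f) -> mono f.
Proof. by move=> e d x y xy; apply: e; rewrite -!compmA xy. Qed.

Lemma epi_idm a : epi (idm a).
Proof. by move=> c g h; rewrite !compm1. Qed.

Lemma mono_idm a : mono (idm a).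
Proof. by move=> c g h; rewrite !comp1m. Qed.

Lemma kernel_mono a b (f : hom a b) k (i : hom k a) : is_kernel f i -> mono i.
Proof.
move=> [fi ki] c g h gh.
have e : f \o (i \o h) = 0 by rewrite compmA fi comp0m.
by have [u [_ uu]] := ki _ _ e; rewrite -(uu _ gh) -(uu h).
Qed.

Lemma cokernel_epi a b (f : hom a b) q (p : hom b q) : is_cokernel f p -> epi p.
Proof.
move=> [pf kp] c g h gh.
have e : (h \o p) \o f = 0 by rewrite -compmA pf compm0.
by have [u [_ uu]] := kp _ _ e; rewrite -(uu _ gh) -(uu h).
Qed.

Lemma kernel_lift a b (f : hom a b) k (i : hom k a) c (g : hom c a) :
  is_kernel f i -> f \o g = 0 -> exists u, i \o u = g.
Proof. by move=> ki /(ki.2 _) [u []]; exists u. Qed.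

Lemma cokernel_desc a b (f : hom a b) q (p : hom b q) c (g : hom b c) :
  is_cokernel f p -> g \o f = 0 -> exists u, u \o p = g.
Proof. by move=> kp /(kp.2 _) [u []]; exists u. Qed.

Lemma kernel_intro a b (f : hom a b) k (i : hom k a) :
  mono i -> f \o i = 0 ->
  (forall c (g : hom c a), f \o g = 0 -> exists u, i \o u = g) ->
  is_kernel f i.
Proof.
move=> mi fi L; split=> // c g /L [u iu]; exists u; split=> // v iv.
by apply: mi; rewrite iu.
Qed.

Lemma cokernel_intro a b (f : hom a b) q (p : hom b q) :
  epi p -> p \o f = 0 ->
  (forall c (g : hom b c), g \o f = 0 -> exists u, u \o p = g) ->
  is_cokernel f p.
Proof.
move=> ep pf L; split=> // c g /L [u up]; exists u; split=> // v vp.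
by apply: ep; rewrite up.
Qed.

Lemma kernel_post_mono a b c (f : hom a b) (j : hom b c) k (i : hom k a) :
  mono j -> is_kernel f i -> is_kernel (j \o f) i.
Proof.
move=> mj ki; apply: kernel_intro; first exact: kernel_mono ki.
  by rewrite -compmA ki.1 compm0.
move=> d g; rewrite -compmA => /((mono0P j).1 mj); exact: kernel_lift.
Qed.

Lemma cokernel_pre_epi a b c (f : hom a b) (e : hom c a) q (p : hom b q) :
  epi e -> is_cokernel f p -> is_cokernel (f \o e) p.
Proof.
move=> ee kp; apply: cokernel_intro; first exact: cokernel_epi kp.
  by rewrite compmA kp.1 comp0m.
move=> d g; rewrite compmA => /((epi0P e).1 ee); exact: cokernel_desc.
Qed.

Lemma biprod_ses a b s (i1 : hom a s) (i2 : hom b s) (p1 : hom s a)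
    (p2 : hom s b) : is_biprod i1 i2 p1 p2 -> is_ses i1 p2.
Proof.
move=> [e11 e22 e12 e21 e]; split.
  apply: kernel_intro => // [c g h gh|c g p2g].
    by rewrite -(comp1m g) -e11 -compmA gh compmA e11 comp1m.
  exists (p1 \o g); rewrite -[RHS]comp1m -e compmDl -!compmA p2g.
  by rewrite !compm0 addr0.
apply: cokernel_intro => // [c g h gh|c g gi1].
  by rewrite -(compm1 g) -e22 compmA gh -compmA e22 compm1.
by exists (g \o i2); rewrite -[RHS](compm1 g) -e compmDr !compmA gi1 comp0m add0r.
Qed.

Lemma is_zero_epi a b (f : hom a b) : is_zero a -> epi f -> is_zero b.
Proof.
move=> za ef.
have b0 : idm b = 0 by apply: ef; rewrite comp1m comp0m; apply: za.2.
by split=> c g; [rewrite -[g]comp1m b0 comp0m|rewrite -[g]compm1 b0 compm0].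
Qed.

Lemma is_zero_iso a b : is_zero a -> is_zero b -> iso a b.
Proof.
move=> za zb; exists 0, 0.
by rewrite !compm0 (za.1 _ (idm a)) (zb.1 _ (idm b)).
Qed.

Definition is_pullback a b c (f : hom a c) (g : hom b c) q (pa : hom q a)
    (pb : hom q b) :=
  f \o pa = g \o pb /\
  forall z (x : hom z a) (y : hom z b), f \o x = g \o y ->
    exists! w : hom z q, pa \o w = x /\ pb \o w = y.

Lemma pullback_lift a b c (f : hom a c) (g : hom b c) q (pa : hom q a)
    (pb : hom q b) z (x : hom z a) (y : hom z b) :
  is_pullback f g pa pb -> f \o x = g \o y ->
  exists w, pa \o w = x /\ pb \o w = y.
Proof. by move=> [_ H] /H [w []]; exists w. Qed.

Lemma pullback_ext a b c (f : hom a c) (g : hom b c) q (pa : hom q a)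
    (pb : hom q b) z (v w : hom z q) :
  is_pullback f g pa pb -> pa \o v = pa \o w -> pb \o v = pb \o w -> v = w.
Proof.
move=> [e H] ea eb; have e' : f \o (pa \o w) = g \o (pb \o w) by rewrite !compmA e.
by have [u [_ uu]] := H _ _ _ e'; rewrite -(uu v) // -(uu w).
Qed.

End PreadditiveLemmas.

(** * The opposite category *)

Section Opposite.

(** Objects and hom groups are reused as they are, so predicates such as [is_ses] over [opp (opp A)]
    convert to those over [A], and dual statements come from instantiating at [opp A]. *)
Definition opp_preadd (A : preaddCat) : preaddCat :=
  @PreaddCat A (fun a b => hom b a) (fun a => idm a)
    (fun a b c g f => f \o g)
    (fun a b f => compm1 f) (fun a b f => comp1m f)
    (fun a b c d h g f => esym (compmA f g h))
    (fun a b c g g' f => compmDr f g g') (fun a b c g f f' => compmDl f f' g).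

Variable A : abelianCat.

Fact opp_zero_obP : @is_zero (opp_preadd A) (zero_ob A).
Proof. by split=> a f; [apply: (zero_obP A).2|apply: (zero_obP A).1]. Qed.

Fact opp_has_biprod (a b : opp_preadd A) : exists s (i1 : hom a s)
  (i2 : hom b s) (p1 : hom s a) (p2 : hom s b), is_biprod i1 i2 p1 p2.
Proof.
have [s [i1 [i2 [p1 [p2 [? ? ? ? ?]]]]]] := @has_biprod A a b.
by exists s, p1, p2, i1, i2; split.
Qed.

Definition opp : abelianCat :=
  @AbelianCat (opp_preadd A) (zero_ob A) opp_zero_obP opp_has_biprod
    (fun a b f => @has_cokernel A b a f) (fun a b f => @has_kernel A b a f)
    (fun a b f => @epi_normal A b a f) (fun a b f => @mono_normal A b a f).

End Opposite.

Section AbelianLemmas.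
Variable A : abelianCat.
Implicit Types a b c z : A.

(** The epimorphism [p] is a cokernel of some [h]. Since [h] factors through the kernel [i],
    whatever kills [i] kills [h]. *)
Lemma epi_cokernel a b (p : hom a b) k (i : hom k a) :
  epi p -> is_kernel p i -> is_cokernel i p.
Proof.
move=> ep ki; apply: cokernel_intro => //; first exact: ki.1.
move=> c g gi; have [d [h ch]] := epi_normal ep.
have [v iv] := kernel_lift ki ch.1.
by apply: (cokernel_desc ch); rewrite -iv compmA gi comp0m.
Qed.

Lemma ses_of_kernel a b (p : hom a b) k (i : hom k a) :
  epi p -> is_kernel p i -> is_ses i p.
Proof. by move=> ep ki; split=> //; apply: epi_cokernel. Qed.

End AbelianLemmas.

Lemma ses_of_cokernel (A : abelianCat) (a b : A) (i : hom a b) q (p : hom b q) :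
  mono i -> is_cokernel i p -> is_ses i p.
Proof. by move=> mi kp; split=> //; exact: (@epi_cokernel (opp A) _ _ i _ p). Qed.

Section Ses.
Variable A : abelianCat.
Implicit Types a b c z : A.

Lemma ses_mono a b c (i : hom a b) (p : hom b c) : is_ses i p -> mono i.
Proof. by case=> /kernel_mono. Qed.

Lemma ses_epi a b c (i : hom a b) (p : hom b c) : is_ses i p -> epi p.
Proof. by case=> _ /cokernel_epi. Qed.

Lemma ses0 a b c (i : hom a b) (p : hom b c) : is_ses i p -> p \o i = 0.
Proof. by case=> -[]. Qed.

Lemma ses_lift a b c (i : hom a b) (p : hom b c) z (g : hom z b) :
  is_ses i p -> p \o g = 0 -> exists u, i \o u = g.
Proof. by case=> k _; apply: kernel_lift. Qed.

Lemma ses_desc a b c (i : hom a b) (p : hom b c) z (g : hom b z) :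
  is_ses i p -> g \o i = 0 -> exists u, u \o p = g.
Proof. by case=> _ k; apply: cokernel_desc. Qed.

Lemma opp_ses a b c (i : hom a b) (p : hom b c) :
  is_ses i p -> @is_ses (opp A) c b a p i.
Proof. by case. Qed.

Lemma has_ses_epi a b (p : hom a b) : epi p -> exists k (i : hom k a), is_ses i p.
Proof.
by move=> ep; have [k [i ki]] := has_kernel p; exists k, i; apply: ses_of_kernel.
Qed.

Lemma has_ses_mono a b (i : hom a b) : mono i -> exists k (p : hom b k), is_ses i p.
Proof.
move=> ei; have [k [p kp]] := has_cokernel i; exists k, p.
exact: ses_of_cokernel.
Qed.

Lemma ses_zero_right a z : is_zero z -> is_ses (idm a) (0 : hom a z).
Proof.
move=> zz; split.
  apply: kernel_intro; [exact: mono_idm|by rewrite comp0m|].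
  by move=> c g _; exists g; rewrite comp1m.
apply: cokernel_intro; [|by rewrite comp0m|].
  by move=> c g h _; rewrite (zz.2 _ g) (zz.2 _ h).
by move=> c g; rewrite compm1 => ->; exists 0; rewrite comp0m.
Qed.

Lemma ex_pullback a b c (f : hom a c) (g : hom b c) :
  exists q (pa : hom q a) (pb : hom q b), is_pullback f g pa pb.
Proof.
have [s [i1 [i2 [p1 [p2 [e11 e22 e12 e21 e]]]]]] := has_biprod a b.
have [q [k kk]] := has_kernel ((f \o p1) - (g \o p2)).
exists q, (p1 \o k), (p2 \o k); split.
  by apply/eqP; rewrite -subr_eq0 !compmA -compmBl kk.1.
move=> z x y xy.
have e0 : ((f \o p1) - (g \o p2)) \o ((i1 \o x) + (i2 \o y)) = 0.
  rewrite compmBl !compmDr -!compmA [p1 \o (i1 \o x)]compmA e11 comp1m.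
  rewrite [p1 \o (i2 \o y)]compmA e12 comp0m compm0 addr0.
  rewrite [p2 \o (i2 \o y)]compmA e22 comp1m.
  by rewrite [p2 \o (i1 \o x)]compmA e21 comp0m compm0 add0r xy subrr.
have [w kw] := kernel_lift kk e0; exists w; split.
  rewrite -!compmA kw !compmDr !compmA e11 e12 e21 e22 !comp1m !comp0m.
  by rewrite addr0 add0r.
move=> v [p1v p2v]; apply: (kernel_mono kk); rewrite kw.
by rewrite -[RHS](comp1m (k \o v)) -e compmDl -!compmA -p1v -p2v !compmA.
Qed.

(** The difference map [h] on the biproduct is epi because [h \o i1 = f], and its kernel factors
    through [q]. If [t] kills [pb], then [t \o p2] vanishes on that kernel and so equals [v \o h];
    this [v] kills [f], hence is zero. *)
Lemma pullback_epi a b c (f : hom a c) (g : hom b c) q (pa : hom q a)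
  (pb : hom q b) : is_pullback f g pa pb -> epi f -> epi pb.
Proof.
move=> pq ef.
have [s [i1 [i2 [p1 [p2 [e11 e22 e12 e21 e]]]]]] := has_biprod a b.
set h := (f \o p1) - (g \o p2).
have hi1 : h \o i1 = f.
  by rewrite compmBl -!compmA e11 e21 compm0 subr0 compm1.
have eh : epi h by apply: (@epi_compl _ _ _ _ _ i1); rewrite hi1.
have [k [i si]] := has_ses_epi eh.
apply/epi0P => d t tpb.
have tp2i : (t \o p2) \o i = 0.
  have : f \o (p1 \o i) = g \o (p2 \o i).
    by apply/eqP; rewrite -subr_eq0 !compmA -compmBl (ses0 si).
  move=> /(pullback_lift pq) [w [_ e2]].
  by rewrite -compmA -e2 compmA tpb comp0m.
have [v vh] := ses_desc si tp2i.
have v0 : v = 0.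
  by apply: (epi0P f).1 => //; rewrite -hi1 compmA vh -compmA e21 compm0.
by rewrite -[t]compm1 -e22 compmA -vh v0 !comp0m.
Qed.

(** The substitute for choosing a preimage of an element: a lift exists after passing to a cover [q]
    of the source. *)
Lemma epi_lift a b c (p : hom b c) (f : hom a c) : epi p ->
  exists z (q : hom z a) (g : hom z b), epi q /\ p \o g = f \o q.
Proof.
move=> ep; have [z [g [q pq]]] := ex_pullback p f.
by exists z, q, g; split; [apply: pullback_epi pq ep|exact: pq.1].
Qed.

Lemma ses_pullback a b c (i : hom a b) (p : hom b c) d (h : hom d c) :
  is_ses i p -> exists e (i' : hom a e) (p' : hom e d) (g : hom e b),
    [/\ is_ses i' p', g \o i' = i & p \o g = h \o p'].
Proof.
move=> s; have [q [g [p' pq]]] := ex_pullback p h.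
have e : p \o i = h \o (0 : hom a d) by rewrite compm0 (ses0 s).
have [i' [gi' p'i']] := pullback_lift pq e.
exists q, i', p', g; split=> //; last exact: pq.1.
apply: ses_of_kernel; first exact: pullback_epi pq (ses_epi s).
apply: kernel_intro => //.
  by apply: (@mono_compr _ _ _ _ g); rewrite gi'; apply: ses_mono s.
move=> z x p'x.
have : p \o (g \o x) = 0 by rewrite compmA pq.1 -compmA p'x compm0.
move=> /(ses_lift s) [u iu]; exists u; apply: (pullback_ext pq).
  by rewrite compmA gi'.
by rewrite compmA p'i' comp0m p'x.
Qed.

End Ses.

Lemma ses_pushout (A : abelianCat) (a b c : A) (i : hom a b) (p : hom b c) d
    (f : hom a d) :
  is_ses i p -> exists e (i' : hom d e) (p' : hom e c) (g : hom b e),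
    [/\ is_ses i' p', g \o i = i' \o f & p' \o g = p].
Proof.
move=> /opp_ses /(@ses_pullback (opp A) _ _ _ p i d f) [e [i' [p' [g [s e1 e2]]]]].
exists e, p', i', g; split=> //; exact: (@opp_ses (opp A) _ _ _ i' p').
Qed.

Section Biproducts.
Variables (A : preaddCat) (a b s : A) (i1 : hom a s) (i2 : hom b s).
Variables (p1 : hom s a) (p2 : hom s b).
Hypothesis bp : is_biprod i1 i2 p1 p2.

Lemma biprod_copair c (f : hom a c) (g : hom b c) :
  exists h : hom s c, h \o i1 = f /\ h \o i2 = g.
Proof.
case: bp => e11 e22 e12 e21 _; exists ((f \o p1) + (g \o p2)).
rewrite !compmDl -!compmA e11 e12 e21 e22 !compm0 !compm1.
by rewrite addr0 add0r.
Qed.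

Lemma biprod_pair c (f : hom c a) (g : hom c b) :
  exists h : hom c s, p1 \o h = f /\ p2 \o h = g.
Proof.
case: bp => e11 e22 e12 e21 _; exists ((i1 \o f) + (i2 \o g)).
rewrite !compmDr !compmA e11 e12 e21 e22 !comp0m !comp1m.
by rewrite addr0 add0r.
Qed.

Lemma biprod_in_ext c (h k : hom s c) :
  h \o i1 = k \o i1 -> h \o i2 = k \o i2 -> h = k.
Proof.
case: bp => _ _ _ _ e h1 h2.
by rewrite -[h]compm1 -[k]compm1 -e !compmDr !compmA h1 h2.
Qed.

Lemma biprod_out_ext c (h k : hom c s) :
  p1 \o h = p1 \o k -> p2 \o h = p2 \o k -> h = k.
Proof.
case: bp => _ _ _ _ e h1 h2.
by rewrite -[h]comp1m -[k]comp1m -e !compmDl -!compmA h1 h2.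
Qed.

End Biproducts.

(** * Fibre products and pushouts of short exact sequences *)

Section SesConstructions.
Variable A : abelianCat.
Implicit Types a b c z : A.

(** [P] is the sum of [p] and the identity of [c]. Enlarging the right end while keeping the left
    one serves to make a map out of the right end epi, and to add a summand to a finite
    resolution. *)
Lemma ses_biprod_right a m J c (i : hom a m) (p : hom m J)
    S (i1 : hom m S) (i2 : hom c S) (p1 : hom S m) (p2 : hom S c)
    T (j1 : hom J T) (j2 : hom c T) (r1 : hom T J) (r2 : hom T c) :
  is_ses i p -> is_biprod i1 i2 p1 p2 -> is_biprod j1 j2 r1 r2 ->
  exists P : hom S T,
    [/\ is_ses (i1 \o i) P, P \o i1 = j1 \o p & P \o i2 = j2].
Proof.
move=> s bS bT; have [P [Pi1 Pi2]] := biprod_copair bS (j1 \o p) j2.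
exists P; split=> //.
have [e11 e22 e12 e21 e] := bS; have [f11 f22 f12 f21 f] := bT.
have rP1 : r1 \o P = p \o p1.
  apply: (biprod_in_ext bS); rewrite -!compmA ?Pi1 ?Pi2 ?e11 ?e12 ?f12 ?compm0 //.
  by rewrite compmA f11 comp1m compm1.
have rP2 : r2 \o P = p2.
  by apply: (biprod_in_ext bS);
    rewrite -!compmA ?Pi1 ?Pi2 ?e21 ?e22 // compmA f21 comp0m.
apply: ses_of_kernel.
  apply/epi0P => z g gP; apply: (biprod_in_ext bT); rewrite comp0m.
    by apply: (epi0P p).1; [exact: ses_epi s|rewrite -compmA -Pi1 compmA gP comp0m].
  by rewrite -Pi2 compmA gP comp0m.
apply: kernel_intro.
- apply: mono_comp (ses_mono s); apply: (@mono_compr _ _ _ _ p1).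
  by rewrite e11; apply: mono_idm.
- by rewrite compmA Pi1 -compmA (ses0 s) compm0.
move=> z g Pg.
have /(ses_lift s) [u iu] : p \o (p1 \o g) = 0.
  by rewrite compmA -rP1 -compmA Pg compm0.
exists u; rewrite -compmA iu; apply: (biprod_out_ext bS).
  by rewrite !compmA e11 comp1m.
by rewrite !compmA e21 comp0m comp0m -rP2 -compmA Pg compm0.
Qed.

(** Kernels commute with fibre products, so the point is that [pE] is epi. Lifts [x] and [y] of the
    two components have images in [m1] that differ by some [d] from [c1]; as [q] is epi, [d] lifts
    to [c2] over a cover and corrects [y]. *)
Lemma ses_fiber_product c m J (i : hom c m) (p : hom m J)
    c1 m1 J1 (i1 : hom c1 m1) (p1 : hom m1 J1)
    c2 m2 J2 (i2 : hom c2 m2) (p2 : hom m2 J2)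
    (h : hom c c1) (g : hom m m1) (k : hom J J1)
    (q : hom c2 c1) (f : hom m2 m1) (r : hom J2 J1)
    a (a2 : hom a c2) (a0 : hom a c) L (l2 : hom L J2) (l0 : hom L J) :
  is_ses i p -> is_ses i1 p1 -> is_ses i2 p2 ->
  g \o i = i1 \o h -> p1 \o g = k \o p ->
  f \o i2 = i1 \o q -> p1 \o f = r \o p2 -> epi q ->
  is_pullback q h a2 a0 -> is_pullback r k l2 l0 ->
  exists E (iE : hom a E) (pE : hom E L) (G : hom E m),
    [/\ is_ses iE pE, G \o iE = i \o a0 & p \o G = l0 \o pE].
Proof.
move=> s s1 s2 gi p1g fi2 p1f eq pa pl.
have [E [E2 [E0 pE]]] := ex_pullback f g.
have [e1 _] := pE.
have /(pullback_lift pE) [iE [iE2 iE0]] : f \o (i2 \o a2) = g \o (i \o a0).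
  by rewrite !compmA fi2 gi -!compmA pa.1.
have /(pullback_lift pl) [P [P2 P0]] : r \o (p2 \o E2) = k \o (p \o E0).
  by rewrite !compmA -p1f -p1g -!compmA e1.
exists E, iE, P, E0; split; [|exact: iE0|by rewrite P0].
apply: ses_of_kernel.
  have [z1 [t1 [x [et1 px]]]] := epi_lift l0 (ses_epi s).
  have [z2 [t2 [y [et2 py]]]] := epi_lift (l2 \o t1) (ses_epi s2).
  have /(ses_lift s1) [d id] : p1 \o ((g \o (x \o t2)) - (f \o y)) = 0.
    rewrite compmBr !compmA p1g p1f -!compmA py [p \o (x \o t2)]compmA px.
    by rewrite !compmA -pl.1 subrr.
  have [z3 [t3 [b [et3 qb]]]] := epi_lift d eq.
  have /(pullback_lift pE) [w [w2 w0]] :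
      f \o ((y \o t3) + (i2 \o b)) = g \o (x \o (t2 \o t3)).
    rewrite compmDr [f \o (i2 \o b)]compmA fi2 -[(i1 \o q) \o b]compmA qb.
    by rewrite [i1 \o (d \o t3)]compmA id compmBl -!compmA addrC subrK.
  apply: (@epi_compl _ _ _ _ _ w).
  suff -> : P \o w = t1 \o (t2 \o t3) by apply: epi_comp => //; apply: epi_comp.
  apply: (pullback_ext pl); rewrite compmA.
    by rewrite P2 -compmA w2 compmDr !compmA py (ses0 s2) comp0m addr0.
  by rewrite P0 -compmA w0 !compmA px.
apply: kernel_intro.
- apply/mono0P => z x ix; apply: (pullback_ext pa); rewrite compm0.
    by apply: (ses_mono s2); rewrite compmA -iE2 -compmA ix !compm0.
  by apply: (ses_mono s); rewrite compmA -iE0 -compmA ix !compm0.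
- apply: (pullback_ext pl); rewrite compm0 compmA.
    by rewrite P2 -compmA iE2 compmA (ses0 s2) comp0m.
  by rewrite P0 -compmA iE0 compmA (ses0 s) comp0m.
move=> z x Px.
have /(ses_lift s2) [u2 iu2] : p2 \o (E2 \o x) = 0.
  by rewrite compmA -P2 -compmA Px compm0.
have /(ses_lift s) [u0 iu0] : p \o (E0 \o x) = 0.
  by rewrite compmA -P0 -compmA Px compm0.
have /(pullback_lift pa) [u [u2E u0E]] : q \o u2 = h \o u0.
  apply: (ses_mono s1); rewrite !compmA -fi2 -gi -!compmA iu2 iu0.
  by rewrite !compmA e1.
exists u; apply: (pullback_ext pE); rewrite compmA.
  by rewrite iE2 -compmA u2E.
by rewrite iE0 -compmA u0E.
Qed.

Lemma is_pullback_idm c : is_pullback (idm c) (idm c) (idm c) (idm c).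
Proof.
split=> // z x y; rewrite !comp1m => ->; exists y; split; first by rewrite comp1m.
by move=> w [e _]; rewrite -e comp1m.
Qed.

Lemma ses_map_pullback c m J (i : hom c m) (p : hom m J)
    m1 J1 (i1 : hom c m1) (p1 : hom m1 J1) (g : hom m m1) (k : hom J J1) :
  is_ses i p -> is_ses i1 p1 -> g \o i = i1 -> p1 \o g = k \o p ->
  is_pullback p1 k g p.
Proof.
move=> s s1 gi p1g; split=> // z x y xy.
have [z1 [t [w [et pw]]]] := epi_lift y (ses_epi s).
have /(ses_lift s1) [d i1d] : p1 \o ((x \o t) - (g \o w)) = 0.
  by rewrite compmBr !compmA p1g xy -!compmA pw subrr.
(* Over the cover [z1], the lift [w] of [y] is corrected by the defect [d], which lives in the
   common kernel [c]. *)
pose w' := w + (i \o d).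
have gw' : g \o w' = x \o t.
  by rewrite compmDr compmA gi i1d addrC subrK.
have pw' : p \o w' = y \o t.
  by rewrite compmDr compmA (ses0 s) comp0m addr0.
have mo z2 (v v' : hom z2 m) : g \o v = g \o v' -> p \o v = p \o v' -> v = v'.
  move=> gv pv.
  have /(ses_lift s) [d' id'] : p \o (v - v') = 0 by rewrite compmBr pv subrr.
  apply/eqP; rewrite -subr_eq0 -id'; apply/eqP.
  suff -> : d' = 0 by rewrite compm0.
  apply: (ses_mono s1); rewrite compm0 -gi -compmA id' compmBr gv subrr //.
(* Joint monicity of [g] and [p] shows that [w'] vanishes on the kernel of the cover [t], so it
   descends to [z]. *)
have [k0 [ik sk]] := has_ses_epi et.
have wk : w' \o ik = 0.
  by apply: mo; rewrite compm0 compmA ?gw' ?pw' -compmA (ses0 sk) compm0.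
have [v vt] := ses_desc sk wk; exists v; split.
  by split; apply: et; rewrite -compmA vt.
by move=> v' [gv' pv']; apply: mo; rewrite ?gv' ?pv'; apply: et; rewrite -compmA vt.
Qed.

End SesConstructions.

Lemma ses_map_pushout (A : abelianCat) (a b c d m : A) (i : hom a b)
    (p : hom b c) (i' : hom d m) (p' : hom m c) (g : hom b m) (f : hom a d)
    z (x : hom b z) (y : hom d z) :
  is_ses i p -> is_ses i' p' -> g \o i = i' \o f -> p' \o g = p ->
  x \o i = y \o f -> exists w : hom m z, w \o g = x /\ w \o i' = y.
Proof.
move=> /opp_ses s /opp_ses s' e1 e2.
have pb := @ses_map_pullback (opp A) _ _ _ _ _ _ _ _ _ _ _ s' s e2 e1.
by move=> xy; have [w [w1 w2]] := pullback_lift pb xy; exists w.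
Qed.

Lemma ses_map_pushout_ext (A : abelianCat) (a b c d m : A) (i : hom a b)
    (p : hom b c) (i' : hom d m) (p' : hom m c) (g : hom b m) (f : hom a d)
    z (x y : hom m z) :
  is_ses i p -> is_ses i' p' -> g \o i = i' \o f -> p' \o g = p ->
  x \o g = y \o g -> x \o i' = y \o i' -> x = y.
Proof.
move=> /opp_ses s /opp_ses s' e1 e2.
have pb := @ses_map_pullback (opp A) _ _ _ _ _ _ _ _ _ _ _ s' s e2 e1.
exact: (pullback_ext pb).
Qed.

(** * Dimension shifting for Yoneda Ext *)

Section DimensionShift.
Variables (A : abelianCat) (C : A).

(* [q] lifts to a morphism of extensions with target [E]. Requiring the maps [r]
   between the intermediate syzygies to be epi makes the property invariant
   under morphisms of extensions in both directions. *)
Fixpoint yext_lift (n : nat) :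
    forall B' B : A, hom B' B -> yext n B C -> Prop :=
  match n return forall B' B : A, hom B' B -> yext n B C -> Prop with
  | 0 => fun B' B q E =>
      exists (E' : ses B' C) (g : hom (ses_mid E') (ses_mid E)),
        g \o ses_inj E' = ses_inj E \o q /\ ses_surj E \o g = ses_surj E'
  | m.+1 => fun B' B q E =>
      let: existT J (s, t) := E in
      exists (J' : A) (r : hom J' J) (s' : ses B' J')
        (g : hom (ses_mid s') (ses_mid s)),
        [/\ epi r, g \o ses_inj s' = ses_inj s \o q,
            ses_surj s \o g = r \o ses_surj s' & yext_lift r t]
  end.

Lemma yext_lift_map n B' B (q : hom B' B) (t : yext n B C) :
  yext_lift q t -> exists t' : yext n B' C, yext_map q t' t.
Proof.
elim: n => [|n IHn] in B' B q t *.
  by move=> [E' [g H]]; exists E', g.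
case: t => J [s t] /= [J' [r [s' [g [_ e1 e2 /IHn [t' H]]]]]].
by exists (existT _ J' (s', t')); exists g, r.
Qed.

Lemma yext_lift_idm n B (t : yext n B C) : yext_lift (idm B) t.
Proof.
elim: n => [|n IHn] in B t *.
  by exists t, (idm _); rewrite comp1m !compm1.
case: t => J [s t]; exists J, (idm J), s, (idm _).
by split; rewrite ?comp1m ?compm1 //; apply: epi_idm.
Qed.

(** Term by term, the fibre product over [u] of [t] and the lift of [u]. The map between syzygies is
    a pullback of the epimorphism [r], so it is epi again and the induction continues. *)
Lemma yext_lift_pullback n B B1 (h : hom B B1) (t : yext n B C)
    (u : yext n B1 C) B2 (q : hom B2 B1) a (a2 : hom a B2) (a0 : hom a B) :
  yext_map h t u -> epi q -> is_pullback q h a2 a0 ->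
  yext_lift q u -> yext_lift a0 t.
Proof.
elim: n => [|n IHn] in B B1 h t u B2 q a a2 a0 *.
  move=> [g [gi pg]] eq pa [E2 [f [fi pf]]].
  rewrite -[ses_surj t]comp1m in pg; rewrite -[ses_surj E2]comp1m in pf.
  have [E [iE [pE [G [s e1 e2]]]]] := ses_fiber_product (sesP t) (sesP u)
    (sesP E2) gi pg fi pf eq pa (is_pullback_idm C).
  by exists (Ses s), G; split=> //; rewrite e2 comp1m.
case: t u => J [s t] [J1 [s1 t1]] /= [g [k [gi pg km]]] eq pa.
move=> [J2 [r [s2 [f [er fi pf rl]]]]].
have [L [l2 [l0 pl]]] := ex_pullback r k.
have [E [iE [pE [G [sE e1 e2]]]]] := ses_fiber_product (sesP s) (sesP s1)
  (sesP s2) gi pg fi pf eq pa pl.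
exists L, l0, (Ses sE), G; split=> //; first exact: pullback_epi pl er.
exact: IHn km er pl rl.
Qed.

(** Pushing the lift out along [k] leaves a map [h' \o r] between syzygies that need not be epi.
    Adding [ses_mid s1] to the middle and the right of the pushed sequence repairs this, since
    [ses_surj s1] is epi. *)
Lemma yext_lift_push n B B1 (h : hom B B1) (t : yext n B C)
    (u : yext n B1 C) B' B1' (q : hom B' B) (q1 : hom B1' B1) (k : hom B' B1') :
  yext_map h t u -> q1 \o k = h \o q -> yext_lift q t -> yext_lift q1 u.
Proof.
elim: n => [|n IHn] in B B1 h t u B' B1' q q1 k *.
  move=> [g [gi pg]] qk [E [f [fi pf]]].
  have [m [i [p [l [s li pl]]]]] := ses_pushout k (sesP E).
  have [G [Gl Gi]] : exists w, w \o l = g \o f /\ w \o i = ses_inj u \o q1.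
    apply: (ses_map_pushout (sesP E) s li pl).
    by rewrite -compmA fi !compmA gi -!compmA qk.
  exists (Ses s), G; split=> //=.
  apply: (ses_map_pushout_ext (sesP E) s li pl).
    by rewrite -compmA Gl pl compmA pg pf.
  by rewrite -compmA Gi compmA (ses0 s) (ses0 (sesP u)) comp0m.
case: t u => J [s t] [J1 [s1 t1]] /= [g [h' [gi pg hm]]] qk.
move=> [J' [r [s' [f [er fi pf rl]]]]].
have [m [i [p [l [sm li pl]]]]] := ses_pushout k (sesP s').
have [G [Gl Gi]] : exists w, w \o l = g \o f /\ w \o i = ses_inj s1 \o q1.
  apply: (ses_map_pushout (sesP s') sm li pl).
  by rewrite -compmA fi !compmA gi -!compmA qk.
have pG : ses_surj s1 \o G = (h' \o r) \o p.
  apply: (ses_map_pushout_ext (sesP s') sm li pl).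
    by rewrite -!compmA Gl pl compmA pg -compmA pf.
  by rewrite -!compmA Gi compmA (ses0 sm) (ses0 (sesP s1)) comp0m !compm0.
have [S [i1 [i2 [p1 [p2 bS]]]]] := has_biprod m (ses_mid s1).
have [T [j1 [j2 [r1 [r2 bT]]]]] := has_biprod J' (ses_mid s1).
have [P [sP Pi1 Pi2]] := ses_biprod_right sm bS bT.
have [R [Rj1 Rj2]] := biprod_copair bT (h' \o r) (ses_surj s1).
have [H [Hi1 Hi2]] := biprod_copair bS G (idm (ses_mid s1)).
exists T, R, (Ses sP), H; split=> /=.
- by apply: (@epi_compl _ _ _ _ _ j2); rewrite Rj2; apply: ses_epi (sesP s1).
- by rewrite compmA Hi1.
- apply: (biprod_in_ext bS); rewrite -!compmA ?Hi1 ?Hi2 ?Pi1 ?Pi2.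
    by rewrite compmA Rj1.
  by rewrite Rj2 compm1.
exact: (IHn _ _ _ _ _ _ _ _ _ j1 hm Rj1 rl).
Qed.

(* A class invariant which holds when [s] splits; for [E] the splice of a short
   exact sequence [s] with [t], it says that [t] comes from the middle term of
   [s]. This replaces exactness of the long exact sequence of Yoneda Ext. *)
Definition yext_split_lift n B (E : yext n.+1 B C) :=
  let: existT J (s, t) := E in yext_lift (ses_surj s) t.

(** Forwards, the lift is pushed along the middle map [g]. Backwards, the identity on the left end
    makes the square of surjections a pullback, along which the lift is pulled back. *)
Lemma yext_split_lift_map n B (E E' : yext n.+1 B C) :
  yext_map (idm B) E E' -> yext_split_lift E <-> yext_split_lift E'.
Proof.
case: E E' => J [s t] [J' [s' t']] /= [g [h [gi pg hm]]].
rewrite compm1 in gi; split=> L.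
  exact: (yext_lift_push hm (k := g) _ L).
have pb := ses_map_pullback (sesP s) (sesP s') gi pg.
exact: yext_lift_pullback hm (ses_epi (sesP s')) pb L.
Qed.

Lemma yext_split_lift_equiv n B (E E' : yext n.+1 B C) :
  yext_equiv E E' -> yext_split_lift E <-> yext_split_lift E'.
Proof.
elim=> // [x y /yext_split_lift_map //|x y _ e|x y z _ e1 _ e2].
  by split=> /e.
by split=> [/e1/e2|/e2/e1].
Qed.

(** Vanishing for [K] makes the splice of [s] with [t] equivalent to the splice of the split
    sequence with [t]. There [p2] has the section [i2], and the trivial lift of [t] becomes a lift
    along [p2]. *)
Lemma ext_zero_lift n K B D (i : hom K B) (p : hom B D) :
  is_ses i p -> ext_zero n.+1 C K -> forall t : yext n D C,
  exists t' : yext n B C, yext_map p t' t.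
Proof.
move=> s zK t; apply: yext_lift_map.
have [S [i1 [i2 [p1 [p2 bS]]]]] := has_biprod K D.
have := @yext_split_lift_equiv n K (existT _ D (Ses s, t))
  (existT _ D (Ses (biprod_ses bS), t)) (zK _ _).
case=> _; apply => /=.
apply: (@yext_lift_push n D D (idm D) t t D S (idm D) p2 i2).
- elim: n D t {zK s S i1 i2 p1 p2 bS i p} => [|n IHn] D t.
    by exists (idm _); rewrite !comp1m !compm1.
  case: t => J [s t]; exists (idm _), (idm _).
  by split; rewrite ?comp1m ?compm1 //.
- by case: bS => _ -> _ _ _; rewrite comp1m.
exact: yext_lift_idm.
Qed.

End DimensionShift.

Section Pushforward.
Variables (A : abelianCat) (C : A).

Lemma yext_map_refl n B (t : yext n B C) : yext_map (idm B) t t.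
Proof.
elim: n => [|n IHn] in B t *.
  by exists (idm _); rewrite !comp1m !compm1.
case: t => J [s t]; exists (idm _), (idm _).
by split; rewrite ?comp1m ?compm1.
Qed.

Lemma yext_map_comp n B1 B2 B3 (f : hom B1 B2) (g : hom B2 B3)
    (t1 : yext n B1 C) (t2 : yext n B2 C) (t3 : yext n B3 C) :
  yext_map f t1 t2 -> yext_map g t2 t3 -> yext_map (g \o f) t1 t3.
Proof.
elim: n => [|n IHn] in B1 B2 B3 f g t1 t2 t3 *.
  move=> [x [x1 x2]] [y [y1 y2]]; exists (y \o x).
  by rewrite -compmA x1 compmA y1 compmA compmA y2 x2.
case: t1 t2 t3 => J1 [s1 t1] [J2 [s2 t2]] [J3 [s3 t3]] /=.
move=> [x [h [x1 x2 xm]]] [y [k [y1 y2 ym]]].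
exists (y \o x), (k \o h); split; last exact: IHn xm ym.
  by rewrite -compmA x1 compmA y1 compmA.
by rewrite compmA y2 -compmA x2 compmA.
Qed.

(** Only the leftmost short exact sequence is pushed out. That the result maps to every other target
    of a morphism over [f] is what makes such targets unique up to equivalence. *)
Lemma yext_pushforward n B D (f : hom B D) (t : yext n B C) :
  exists u : yext n D C, yext_map f t u /\
    forall v : yext n D C, yext_map f t v -> yext_map (idm D) u v.
Proof.
case: n t => [|n] t.
  have [m [i [p [l [s li pl]]]]] := ses_pushout f (sesP t).
  exists (Ses s); split=> [|v [g [gi pg]]]; first by exists l.
  have [G [Gl Gi]] := ses_map_pushout (sesP t) s li pl gi.
  exists G; rewrite compm1; split=> //.
  apply: (ses_map_pushout_ext (sesP t) s li pl).
    by rewrite -compmA Gl pg pl.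
  by rewrite -compmA Gi (ses0 s) (ses0 (sesP v)).
case: t => J [r t].
have [m [i [p [l [s li pl]]]]] := ses_pushout f (sesP r).
exists (existT _ J (Ses s, t)); split=> [|[J' [r' t']] [g [h [gi pg hm]]]].
  by exists l, (idm J); rewrite comp1m; split=> //; apply: yext_map_refl.
have [G [Gl Gi]] := ses_map_pushout (sesP r) s li pl gi.
exists G, h; rewrite compm1; split=> //.
apply: (ses_map_pushout_ext (sesP r) s li pl).
  by rewrite -!compmA Gl pg pl.
by rewrite -!compmA Gi (ses0 s) (ses0 (sesP r')) compm0.
Qed.

Lemma yext_map_equiv n B D (f : hom B D) (t t' : yext n B C) (u u' : yext n D C) :
  yext_equiv t t' -> yext_map f t u -> yext_map f t' u' -> yext_equiv u u'.
Proof.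
move=> e; elim: e u u' => {t t'} [t t' tt' u u' tu tu'|t u u' tu tu'
    |t t' _ IH u u' tu tu'|t1 t2 t3 _ IH1 _ IH2 u1 u3 tu1 tu3].
- have [w [tw wu]] := yext_pushforward f t.
  apply: (rst_trans _ _ _ w); first by apply/rst_sym/rst_step/wu.
  by apply/rst_step/wu; rewrite -[f]compm1; apply: yext_map_comp tt' tu'.
- have [w [tw wu]] := yext_pushforward f t.
  apply: (rst_trans _ _ _ w); first by apply/rst_sym/rst_step/wu.
  exact/rst_step/wu.
- exact/rst_sym/IH.
have [u2 [tu2 _]] := yext_pushforward f t2.
by apply: (rst_trans _ _ _ u2); [apply: IH1 tu1 tu2|apply: IH2 tu2 tu3].
Qed.

(** Exactness of Ext^(n+1)(C, B) -> Ext^(n+1)(C, D) -> Ext^(n+2)(C, K): two extensions over [D] lift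
    to [B], where they are equivalent. *)
Lemma ext_zero_shift n K B D (i : hom K B) (p : hom B D) :
  is_ses i p -> ext_zero n C B -> ext_zero n.+1 C K -> ext_zero n C D.
Proof.
move=> s zB zK E E'.
have [t tE] := ext_zero_lift s zK E; have [t' tE'] := ext_zero_lift s zK E'.
exact: yext_map_equiv (zB t t') tE tE'.
Qed.

End Pushforward.

(** * Yoneda extensions in the opposite category *)

Section Reversal.

Section Snoc.
Variable A : abelianCat.

Fixpoint yext_snoc n (J C : A) (s : ses J C) :
    forall D : A, yext n D J -> yext n.+1 D C :=
  match n return forall D : A, yext n D J -> yext n.+1 D C with
  | 0 => fun D t => existT _ J (t, s)
  | m.+1 => fun D t => let: existT K (r, t') := t in
      existT _ K (r, yext_snoc s t')
  end.

(** Both ends move: after reversal, the map [h] between syzygies becomes a map of right ends, where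
    [yext_map] allows only the identity. *)
Fixpoint yext_map2 (n : nat) (C C' : A) (c : hom C C') :
    forall D D' : A, hom D D' -> yext n D C -> yext n D' C' -> Prop :=
  match n return forall D D' : A, hom D D' -> yext n D C -> yext n D' C' -> Prop
  with
  | 0 => fun D D' f E E' =>
      exists g : hom (ses_mid E) (ses_mid E'),
        g \o ses_inj E = ses_inj E' \o f /\
        ses_surj E' \o g = c \o ses_surj E
  | m.+1 => fun D D' f E E' =>
      let: existT J (s, t) := E in
      let: existT J' (s', t') := E' in
      exists (g : hom (ses_mid s) (ses_mid s')) (h : hom J J'),
        [/\ g \o ses_inj s = ses_inj s' \o f,
            ses_surj s' \o g = h \o ses_surj s
          & yext_map2 c h t t']
  end.

Lemma yext_map2_idm n C D D' (f : hom D D') (t : yext n D C) (t' : yext n D' C) :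
  yext_map2 (idm C) f t t' <-> yext_map f t t'.
Proof.
elim: n => [|n IHn] in D D' f t t' *.
  by split=> -[g [e1 e2]]; exists g; rewrite ?comp1m in e2 *.
case: t t' => J [s t] [J' [s' t']].
by split=> -[g [h [e1 e2 /IHn m]]]; exists g, h.
Qed.

Lemma yext_map2_snoc n C C' (c : hom C C') J J' (h : hom J J') D D'
    (f : hom D D') (t : yext n D J) (t' : yext n D' J') (s : ses J C)
    (s' : ses J' C') (g : hom (ses_mid s) (ses_mid s')) :
  yext_map2 h f t t' -> g \o ses_inj s = ses_inj s' \o h ->
  ses_surj s' \o g = c \o ses_surj s ->
  yext_map2 c f (yext_snoc s t) (yext_snoc s' t').
Proof.
move=> m gi pg; elim: n => [|n IHn] in D D' f t t' m *.
  by case: m => [x [x1 x2]]; exists x, h; split=> //; exists g.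
case: t t' m => K [r t] [K' [r' t']] /= [x [k [x1 x2 m]]].
by exists x, k; split=> //; apply: IHn.
Qed.

End Snoc.

Definition ses_rev (A : abelianCat) (D C : A) (s : ses D C) :
  @ses (opp A) C D := Ses (opp_ses (sesP s)).

Definition ses_unrev (A : abelianCat) (D C : A) (s : @ses (opp A) C D) :
  ses D C :=
  @Ses A D C (ses_mid s) (ses_surj s) (ses_inj s)
    (@opp_ses (opp A) _ _ _ _ _ (sesP s)).

Section Rev.
Variable A : abelianCat.

Fixpoint yext_rev n (C : A) : forall D : A, yext n D C -> @yext (opp A) n C D :=
  match n return forall D : A, yext n D C -> @yext (opp A) n C D with
  | 0 => fun D t => ses_rev t
  | m.+1 => fun D t => let: existT J (s, t') := t in
     @yext_snoc (opp A) m J D (ses_rev s) C (yext_rev t')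
  end.

Fixpoint yext_unrev n (C : A) :
    forall D : A, @yext (opp A) n D C -> yext n C D :=
  match n return forall D : A, @yext (opp A) n D C -> yext n C D with
  | 0 => fun D t => ses_unrev t
  | m.+1 => fun D t => let: existT J (s, t') := t in
      yext_snoc (ses_unrev s) (yext_unrev t')
  end.

Lemma yext_rev_map2 n (C C' : A) (c : hom C C') (D D' : A) (f : hom D D')
    (t : yext n D C) (t' : yext n D' C') :
  yext_map2 c f t t' ->
  @yext_map2 (opp A) n D' D f C' C c (yext_rev t') (yext_rev t).
Proof.
elim: n => [|n IHn] in D D' f t t' *.
  by move=> [g [g1 g2]]; exists g.
case: t t' => J [s t] [J' [s' t']] [g [h [g1 g2 m]]].
exact: (@yext_map2_snoc (opp A) n D' D f J' J h C' C c (yext_rev t')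
  (yext_rev t) (ses_rev s') (ses_rev s) g (IHn _ _ _ _ _ m) g2 g1).
Qed.

Lemma yext_rev_snoc n (J C : A) (s : ses J C) (D : A) (t : yext n D J) :
  yext_rev (yext_snoc s t) = existT _ J (ses_rev s, yext_rev t).
Proof.
elim: n => [|n IHn] in D t *; first by [].
case: t => K [r t].
transitivity (@yext_snoc (opp A) n.+1 K D (ses_rev r) C
    (yext_rev (yext_snoc s t))); first by [].
by rewrite IHn.
Qed.

(** A morphism made of identities is enough for equivalence, and it spares comparing the proofs
    stored in the short exact sequences. *)
Lemma yext_unrevK n (C D : A) (t : @yext (opp A) n D C) :
  @yext_map (opp A) n C D D (idm D) (yext_rev (yext_unrev t)) t.
Proof.
elim: n => [|n IHn] in D t *.
  by exists (@idm (opp A) (ses_mid t)); rewrite !comp1m !compm1.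
case: t => J [s t].
have -> : yext_rev (yext_unrev (existT _ J (s, t) : @yext (opp A) n.+1 D C)) =
    existT _ J (ses_rev (ses_unrev s), yext_rev (yext_unrev t)).
  exact: yext_rev_snoc.
exists (@idm (opp A) (ses_mid s)), (@idm (opp A) J).
by split; rewrite ?comp1m ?compm1.
Qed.

Lemma yext_rev_equiv n (D C : A) (t t' : yext n D C) :
  yext_equiv t t' ->
  yext_equiv (yext_rev t : @yext (opp A) n C D) (yext_rev t').
Proof.
elim=> {t t'} [t t' m|t|t t' _|x y z _ e1 _ e2].
- apply/rst_sym/rst_step/yext_map2_idm.
  by apply: yext_rev_map2; apply/yext_map2_idm.
- exact: rst_refl.
- exact: rst_sym.
exact: rst_trans e1 e2.
Qed.

Lemma ext_zero_opp n (C D : A) : ext_zero n C D -> @ext_zero (opp A) n D C.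
Proof.
move=> z E E'; have e := yext_rev_equiv (z (yext_unrev E) (yext_unrev E')).
apply: rst_trans (rst_step _ _ _ _ (yext_unrevK E')).
by apply: rst_trans e; apply/rst_sym/rst_step/yext_unrevK.
Qed.

End Rev.

End Reversal.

Lemma opp_is_zero (A : abelianCat) (z : A) : is_zero z -> @is_zero (opp A) z.
Proof. by case. Qed.

Lemma ses_zero_left (A : abelianCat) (a z : A) :
  is_zero z -> is_ses (0 : hom z a) (idm a).
Proof.
move=> /opp_is_zero zz.
exact: (@opp_ses (opp A) _ _ _ _ _ (@ses_zero_right (opp A) a z zz)).
Qed.

Section PushoutKernels.
Variables (A : abelianCat) (a b c d m : A) (i : hom a b) (p : hom b c).
Variables (i' : hom d m) (p' : hom m c) (g : hom b m) (f : hom a d).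
Hypotheses (s : is_ses i p) (s' : is_ses i' p').
Hypotheses (gi : g \o i = i' \o f) (pg : p' \o g = p).

Lemma ses_pushout_epi t (k : hom t a) : is_ses k f -> is_ses (i \o k) g.
Proof.
move=> sk; apply: ses_of_kernel.
  apply/epi0P => z h hg.
  have /(ses_desc s') [h' h'p] : h \o i' = 0.
    apply: (epi0P f).1; first exact: ses_epi sk.
    by rewrite -compmA -gi compmA hg comp0m.
  rewrite -h'p; suff -> : h' = 0 by rewrite comp0m.
  apply: (epi0P p).1; first exact: ses_epi s.
  by rewrite -pg compmA h'p hg.
apply: kernel_intro.
- by apply: mono_comp; [apply: ses_mono s|apply: ses_mono sk].
- by rewrite compmA gi -compmA (ses0 sk) compm0.
move=> z y gy.
have /(ses_lift s) [y' iy'] : p \o y = 0 by rewrite -pg -compmA gy compm0.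
have /(ses_lift sk) [y'' ky] : f \o y' = 0.
  by apply: (ses_mono s'); rewrite compmA -gi -compmA iy' gy compm0.
by exists y''; rewrite -compmA ky.
Qed.

Lemma ses_pushout_mono x (r : hom d x) :
  is_ses f r -> exists w : hom m x, is_ses g w.
Proof.
move=> sr.
have [w [wg wi]] : exists w : hom m x, w \o g = 0 /\ w \o i' = r.
  apply: (ses_map_pushout s s' gi pg).
  by rewrite comp0m (ses0 sr).
exists w; apply: ses_of_cokernel.
  apply/mono0P => z y gy.
  have /(ses_lift s) [y' iy'] : p \o y = 0 by rewrite -pg -compmA gy compm0.
  rewrite -iy'; suff -> : y' = 0 by rewrite compm0.
  apply: (ses_mono sr); apply: (ses_mono s').
  by rewrite compmA -gi -compmA iy' gy !compm0.
apply: cokernel_intro => //.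
  by apply: (@epi_compl _ _ _ _ _ i'); rewrite wi; apply: ses_epi sr.
move=> z h hg.
have /(ses_desc sr) [h' h'r] : (h \o i') \o f = 0.
  by rewrite -compmA -gi compmA hg comp0m.
exists h'; apply: (ses_map_pushout_ext s s' gi pg).
  by rewrite -compmA wg hg compm0.
by rewrite -compmA wi.
Qed.

End PushoutKernels.

(** * Relative resolutions *)

Section FirstExt.
Variable A : abelianCat.
Implicit Types C D K B E : A.

Definition ext1_zero C D :=
  forall E (i : hom D E) (p : hom E C), is_ses i p -> exists r, r \o i = idm D.

Lemma retraction_section D E C (i : hom D E) (p : hom E C) (r : hom E D) :
  is_ses i p -> r \o i = idm D -> exists s, p \o s = idm C.
Proof.
move=> s ri.
have /(ses_desc s) [t tp] : (idm E - (i \o r)) \o i = 0.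
  by rewrite compmBl comp1m -compmA ri compm1 subrr.
exists t; apply: (ses_epi s).
by rewrite -compmA tp compmBr compm1 comp1m compmA (ses0 s) comp0m subr0.
Qed.

Lemma section_retraction D E C (i : hom D E) (p : hom E C) (t : hom C E) :
  is_ses i p -> p \o t = idm C -> exists r, r \o i = idm D.
Proof.
move=> s pt.
have /(ses_lift s) [r ir] : p \o (idm E - (t \o p)) = 0.
  by rewrite compmBr compm1 compmA pt comp1m subrr.
exists r; apply: (ses_mono s).
by rewrite compmA ir compmBl comp1m compm1 -compmA (ses0 s) compm0 subr0.
Qed.

(** Having a retraction is invariant under equivalence of extensions, and the biproduct sequence has
    one. *)
Lemma ext_zero_ext1 C D : ext_zero 0 C D -> ext1_zero C D.
Proof.
move=> z E i p s; have [S [i1 [i2 [p1 [p2 bS]]]]] := has_biprod D C.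
pose split (t : yext 0 D C) := exists r, r \o ses_inj t = idm D.
have e : forall t t', yext_equiv t t' -> split t <-> split t'.
  move=> t t'; elim=> {t t'} [t t' [g [gi pg]]|//|? ? _ -> //|? ? ? _ -> _ -> //].
  rewrite compm1 in gi; split=> [[r ri]|[r ri]].
    have [u tu] := retraction_section (sesP t) ri.
    apply: (@section_retraction _ _ _ _ (ses_surj t') (g \o u)).
      exact: sesP.
    by rewrite compmA pg.
  by exists (r \o g); rewrite -compmA gi.
apply/(e (Ses s) (Ses (biprod_ses bS)) (z _ _)).
by exists p1; case: bS.
Qed.

Lemma ext1_extend C D K B (i : hom K B) (p : hom B C) (f : hom K D) :
  ext1_zero C D -> is_ses i p -> exists g, g \o i = f.
Proof.
move=> z /(ses_pushout f) [E [i' [p' [g [s gi pg]]]]].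
have [r ri] := z _ _ _ s; exists (r \o g).
by rewrite -compmA gi compmA ri comp1m.
Qed.

Lemma ext1_zero_right C z : is_zero z -> ext1_zero z C.
Proof.
move=> zz E i p s.
have /(ses_lift s) [u iu] : p \o idm E = 0 by apply: zz.1.
by exists u; apply: (ses_mono s); rewrite compmA iu comp1m compm1.
Qed.

End FirstExt.

Lemma ext1_zero_opp (A : abelianCat) (C D : A) :
  ext1_zero C D -> @ext1_zero (opp A) D C.
Proof.
move=> z E p i /(@opp_ses (opp A)) s; have [r ri] := z _ _ _ s.
exact: retraction_section s ri.
Qed.

Lemma ext1_lift (A : abelianCat) (C D B E : A) (i : hom D B) (p : hom B E)
    (f : hom C E) :
  ext1_zero C D -> is_ses i p -> exists g, p \o g = f.
Proof.
move=> /ext1_zero_opp z /opp_ses s.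
exact: (@ext1_extend (opp A) _ _ _ _ _ _ f z s).
Qed.

Section FiniteResolutions.
Variable A : abelianCat.
Implicit Types (P X W : A -> Prop) (a b c T M K : A).

(* The length is strictly less than [n]: only zero objects have [n = 0]. *)
Fixpoint fin_res P n T : Prop :=
  if n is m.+1 then exists K c (k : hom K c) (p : hom c T),
    [/\ is_ses k p, P c & fin_res P m K]
  else is_zero T.

Lemma subcategory_zero P z : subcategory P -> is_zero z -> P z.
Proof.
move=> sP zz; apply: (sub_iso sP _ (sub_zero sP)).
exact/is_zero_iso/zz/zero_obP.
Qed.

Lemma fin_res1 P M : P M -> fin_res P 1 M.
Proof.
move=> PM; exists (zero_ob A), M, 0, (idm M); split=> //; last exact: zero_obP.
exact: ses_zero_left (zero_obP A).
Qed.

Lemma fin_resS P n M : subcategory P -> fin_res P n M -> fin_res P n.+1 M.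
Proof.
move=> sP; elim: n => [|n IHn] in M *.
  by move=> zM; exact: fin_res1 (subcategory_zero sP zM).
by move=> [K [c [k [p [s Pc /IHn fK]]]]]; exists K, c, k, p.
Qed.

Lemma fin_res_sub P X n M : subclass P X -> fin_res P n M -> fin_res X n M.
Proof.
move=> PX; elim: n => [|n IHn] in M * => //.
by move=> [K [c [k [p [s /PX Pc /IHn fK]]]]]; exists K, c, k, p.
Qed.

Lemma fin_res_biprod P n a b s (i1 : hom a s) (i2 : hom b s) (p1 : hom s a)
    (p2 : hom s b) : subcategory P -> is_biprod i1 i2 p1 p2 ->
  fin_res P n a -> P b -> fin_res P n.+1 s.
Proof.
move=> sP bs /(fin_resS sP) [K [c [k [p [ss Pc fK]]]]] Pb.
have [S [j1 [j2 [r1 [r2 bS]]]]] := has_biprod c b.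
have [Q [sQ _ _]] := ses_biprod_right ss bS bs.
exists K, S, (j1 \o k), Q; split=> //.
exact: sub_biprod bS Pc Pb.
Qed.

(** All degrees are treated together because the shift along [s] calls for degree [m.+1] at the
    syzygy [K]. *)
Lemma ext_zero_fin_res X W C n T : perp X W -> subcategory W ->
  X C -> fin_res W n T -> forall m, ext_zero m C T.
Proof.
move=> XW sW XC; elim: n => [|n IHn] in T *.
  by move=> /(subcategory_zero sW) WT m; apply: XW.
move=> [K [c [k [p [s Wc fK]]]]] m.
by apply: ext_zero_shift s _ _; [apply: XW|apply: IHn].
Qed.

Lemma ext1_zero_fin_res X W C n T : perp X W -> subcategory W ->
  X C -> fin_res W n T -> ext1_zero C T.
Proof.
move=> XW sW XC fT; apply: ext_zero_ext1.
exact: ext_zero_fin_res XW sW XC fT 0%N.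
Qed.

(* Auslander-Buchweitz approximation; the induction goes through the hull
   0 -> K -> Q -> X' -> 0 of the first syzygy K. *)
Lemma fin_res_approx X W n M : subcategory X -> subcategory W ->
  cogenerator W X -> ext_closed X -> fin_res X n M ->
  exists K c (k : hom K c) (p : hom c M),
    [/\ is_ses k p, X c & exists m, fin_res W m K].
Proof.
move=> sX sW [WX cog] eX; elim: n => [|n IHn] in M *.
  move=> zM; exists M, M, 0, (idm M); split; last by exists 0%N.
    exact: ses_zero_left.
    exact: subcategory_zero.
move=> [K [c [k [p [s Xc /IHn]]]]].
move=> [T [XK [t [q [sT XXK [m fT]]]]]].
have [w [x [i [r [sw Ww Xx]]]]] := cog _ XXK.
(* The hull of [K]: [Q] is the quotient of [w] by [T], hence of finite [W]-dimension, and its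
   quotient by [K] is [x]. *)
have [Q [j [r' [g [sQ gi r'g]]]]] := ses_pushout q sw.
have sTQ := ses_pushout_epi sw sQ gi r'g sT.
have [P [k' [p' [g' [sP g'k p'g']]]]] := ses_pushout j s.
(* The pushout keeps the cokernel [x] of [j], so [P] is an extension of [x] by [c]. *)
have [x' sx] := ses_pushout_mono s sP g'k p'g' sQ.
exists Q, P, k', p'; split=> //; first exact: eX sx Xc Xx.
by exists m.+1, T, w, (i \o t), g; split.
Qed.

End FiniteResolutions.

(** * Exact sequences and their syzygies *)

Section ExactSequences.
Variable A : abelianCat.

Definition exact_at (a b c : A) (f : hom a b) (g : hom b c) :=
  exists K (k : hom K b) (u : hom a K), [/\ is_kernel g k, k \o u = f & epi u].

Lemma exact_at0 a b c (f : hom a b) (g : hom b c) : exact_at f g -> g \o f = 0.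
Proof.
by move=> [K [k [u [kk <- _]]]]; rewrite compmA kk.1 comp0m.
Qed.

Lemma exact_at_lift a b c (f : hom a b) (g : hom b c) K (k : hom K b) :
  exact_at f g -> is_kernel g k -> exists u : hom a K, k \o u = f /\ epi u.
Proof.
move=> [K' [k' [u [kk' ku eu]]]] kk.
have [w kw] := kernel_lift kk kk'.1; have [v kv] := kernel_lift kk' kk.1.
exists (w \o u); rewrite compmA kw; split=> //; apply: epi_comp eu.
apply: (@epi_compl _ _ _ _ _ v); suff -> : w \o v = idm K by apply: epi_idm.
by apply: (kernel_mono kk); rewrite compmA kw kv compm1.
Qed.

(* A subobject of the kernel k through which f factors is normal, hence is all
   of k because a map killing f kills k. *)
Lemma cokernel_kernel_exact a b c (f : hom a b) (g : hom b c) :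
  is_cokernel f g -> exact_at f g.
Proof.
move=> kg; have [K [k kk]] := has_kernel g.
have [u ku] := kernel_lift kk kg.1; exists K, k, u; split=> //.
apply/epi0P => z h hu; have [L [l kl]] := has_kernel h.
have [v lv] := kernel_lift kl hu.
have [x [t kt]] := mono_normal (mono_comp (kernel_mono kk) (kernel_mono kl)).
have tf : t \o f = 0 by rewrite -ku -lv !compmA -[(t \o k) \o l]compmA kt.1 comp0m.
have [t' tg] := cokernel_desc kg tf.
have tk : t \o k = 0 by rewrite -tg -compmA kk.1 compm0.
have [w kw] := kernel_lift kt tk.
suff e : l \o w = idm K by rewrite -[h]compm1 -e compmA kl.1 comp0m.
by apply: (kernel_mono kk); rewrite compmA kw compm1.
Qed.

End ExactSequences.

(** The definition of exactness favours kernels, yet it is self-dual: the kernel [k] of [g] is a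
    cokernel in [opp A], and a cokernel of [k] is one of [f] because [u] is epi. *)
Lemma opp_exact_at (A : abelianCat) (a b c : A) (f : hom a b) (g : hom b c) :
  exact_at f g -> @exact_at (opp A) c b a g f.
Proof.
move=> [K [k [u [kk ku eu]]]].
have [Q [q [v [qk vq mv]]]] := @cokernel_kernel_exact (opp A) _ _ _ g k kk.
exists Q, q, v; split=> //; rewrite -ku.
exact: (@cokernel_pre_epi A _ _ _ k u Q q eu qk).
Qed.

Section Sequences.
Variable A : abelianCat.
Variables (a : nat -> A) (d : forall m, hom (a m.+1) (a m)).

(* ... -> a_2 -> a_1 -> a_0 -> 0 *)
Definition exact_seq := epi (d 0) /\ forall m, exact_at (d m.+1) (d m).

Definition hom_exact (C : A) :=
  (forall f : hom C (a 0), exists g, d 0 \o g = f) /\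
  (forall m (f : hom C (a m.+1)), d m \o f = 0 -> exists g, d m.+1 \o g = f).

(** [T] is the image of [d m]. As [j] is mono, [p] and [d m] have the same kernel, the next syzygy,
    which [d m.+1] covers by exactness. *)
Lemma exact_seq_syzygy m T (p : hom (a m.+1) T) (j : hom T (a m)) :
  exact_at (d m.+1) (d m) -> mono j -> epi p -> j \o p = d m ->
  exists K (k : hom K (a m.+1)) (q : hom (a m.+2) K),
    [/\ is_ses k p, is_kernel (d m) k, k \o q = d m.+1 & epi q].
Proof.
move=> ex mj ep jp; have [K [k s]] := has_ses_epi ep.
have kd : is_kernel (d m) k.
  by rewrite -jp; apply: kernel_post_mono mj s.1.
have [q [kq eq]] := exact_at_lift ex kd.
by exists K, k, q.
Qed.

Lemma exact_seq_syzygy_fin_res P n m T (p : hom (a m.+1) T) (j : hom T (a m)) :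
  (forall l, exact_at (d l.+1) (d l)) -> (forall l, P (a l.+1)) ->
  (forall i, n <= i -> is_zero (a (m + i).+1))%N ->
  mono j -> epi p -> j \o p = d m -> fin_res P n T.
Proof.
move=> ex Pa; elim: n => [|n IHn] in m T p j *.
  by move=> /(_ 0%N (leqnn 0)); rewrite addn0 => /is_zero_epi zp _ /zp.
move=> z mj ep jp.
have [K [l [q [s kl lq eq]]]] := exact_seq_syzygy (ex m) mj ep jp.
exists K, (a m.+1), l, p; split=> //.
apply: (IHn m.+1 K q l) => //; last exact: ses_mono s.
by move=> i ki; rewrite addSnnS; apply: z.
Qed.

Lemma exact_seq_fin_res P n : exact_seq -> (forall m, P (a m.+1)) ->
  (forall m, n <= m -> is_zero (a m.+1))%N -> fin_res P n (a 0).
Proof.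
move=> [e0 ex] Pa za.
apply: (@exact_seq_syzygy_fin_res P n 0%N _ (d 0%N) (idm _)) => //.
  exact: mono_idm.
by rewrite comp1m.
Qed.

(** The last hypothesis is the vanishing of relative Ext in degree 1. A map [f] on the first syzygy
    gives the cocycle [f \o q]; writing it as a coboundary extends [f], as [q] is epi. *)
Lemma exact_seq_syzygy_extend (W V : A -> Prop) n :
  exact_seq -> (forall m, W (a m.+1)) ->
  (forall m, n <= m -> is_zero (a m.+2))%N ->
  (forall v (f : hom (a 2) v), V v -> f \o d 2 = 0 -> exists g, g \o d 1 = f) ->
  exists K c (k : hom K c) (p : hom c (a 0)), [/\ is_ses k p, W c, fin_res W n K
    & forall v (f : hom K v), V v -> exists g, g \o k = f].
Proof.
move=> [e0 ex] Wa za ext.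
have [K [k [q [s kk kq eq]]]] :=
  exact_seq_syzygy (ex 0%N) (mono_idm (a:=a 0%N)) e0 (comp1m (d 0%N)).
exists K, (a 1%N), k, (d 0%N); split=> //.
  by apply: (@exact_seq_syzygy_fin_res W n 1%N K q k) => //; apply: ses_mono s.
move=> v f Vv; have [|g gd] := ext v (f \o q) Vv.
  rewrite -compmA; suff -> : q \o d 2 = 0 by apply: compm0.
  by apply: (ses_mono s); rewrite compmA kq (exact_at0 (ex 1%N)) compm0.
by exists g; apply: eq; rewrite -compmA kq.
Qed.

End Sequences.

(** * Extension of maps along proper resolutions *)

Section OneSided.
Variables (A : abelianCat) (X Y W V : A -> Prop).
Hypotheses (subX : subcategory X) (subW : subcategory W).
Hypotheses (cogW : cogenerator W X) (extX : ext_closed X) (genV : generator V Y).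
Hypothesis XW : forall n C T, X C -> fin_res W n T -> ext1_zero C T.
Hypothesis WY : forall C D, W C -> Y D -> ext1_zero C D.
Hypothesis syzygy_extend : forall n T, fin_res W n.+1 T ->
  exists K c (k : hom K c) (p : hom c T), [/\ is_ses k p, W c, fin_res W n K
    & forall v (f : hom K v), V v -> exists g, g \o k = f].

Lemma fin_res_ext1_zero n T D : fin_res W n T -> Y D -> ext1_zero T D.
Proof.
elim: n => [|n IHn] in T D *; first by move=> zT _; apply: ext1_zero_right.
move=> /syzygy_extend [K [c [k [p [s Wc fK ext]]]]] YD E i q sE.
(* To split [sE], a lift [w] of [p] has to vanish on the syzygy [K]. The obstruction is [f]; once
   extended to [c], it is subtracted from [w]. *)
have [w qw] := ext1_lift p (WY Wc YD) sE.
have /(ses_lift sE) [f if_] : q \o (w \o k) = 0.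
  by rewrite compmA qw (ses0 s).
have [D' [v [j [r [sv Vv YD']]]]] := genV.2 _ YD.
(* The kernel [D'] of [r] lies in [Y] again, so the induction hypothesis applies to the pair [K],
   [D']. *)
have [f' rf'] := ext1_lift f (IHn _ _ fK YD') sv.
have [g gk] := ext _ f' Vv.
have /(ses_desc s) [t tp] : (w - (i \o (r \o g))) \o k = 0.
  by rewrite compmBl -!compmA gk rf' if_ subrr.
apply: (@section_retraction _ _ _ _ _ _ t sE); apply: (ses_epi s).
by rewrite -compmA tp compmBr qw !compmA (ses0 sE) !comp0m subr0 comp1m.
Qed.

Definition precover a b (p : hom a b) :=
  forall c, X c -> forall f : hom c b, exists g, p \o g = f.

Lemma fin_res_precover n M : fin_res X n M ->
  exists K c (k : hom K c) (p : hom c M),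
    [/\ is_ses k p, X c, precover p, exists m, fin_res W m K
      & forall D (f : hom K D), Y D -> exists g, g \o k = f].
Proof.
move=> /(fin_res_approx subX subW cogW extX).
move=> [K [c [k [p [s Xc [m fK]]]]]]; exists K, c, k, p; split=> //.
- by move=> d Xd f; apply: ext1_lift (XW Xd fK) s.
- by exists m.
move=> D f YD; have [w [x [i [r [sw Ww Xx]]]]] := cogW.2 _ Xc.
have /has_ses_mono [Q [q sQ]] : mono (i \o k).
  by apply: mono_comp; [apply: ses_mono sw|apply: ses_mono s].
have fQ : fin_res W m.+1 Q by exists K, w, (i \o k), q.
have [g gk] := ext1_extend f (fin_res_ext1_zero fQ YD) sQ.
by exists (g \o i); rewrite -compmA.
Qed.

Definition fin_res_retract M :=
  exists n S (i : hom M S) (r : hom S M), r \o i = idm M /\ fin_res X n S.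

(* Schanuel's argument: comparing with the approximation of S in both
   directions exhibits K as a retract of L + c. *)
Lemma fin_res_retract_syzygy K c M (k : hom K c) (p : hom c M) :
  fin_res_retract M -> is_ses k p -> X c -> precover p ->
  fin_res_retract K /\
  forall D (f : hom K D), Y D -> exists g, g \o k = f.
Proof.
move=> [n [S [i [r [ri fS]]]]] s Xc pc.
have [L [x [l [q [sq Xx qc [m fL] ext]]]]] := fin_res_precover fS.
have [a qa] := qc _ Xc (i \o p).
have [b pb] := pc _ Xx (r \o q).
have /(ses_lift sq) [a' la'] : q \o (a \o k) = 0.
  by rewrite compmA qa -compmA (ses0 s) compm0.
have /(ses_lift s) [b' kb'] : p \o (b \o l) = 0.
  by rewrite compmA pb -compmA (ses0 sq) compm0.
have /(ses_lift s) [h kh] : p \o ((b \o a) - idm c) = 0.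
  by rewrite compmBr compm1 compmA pb -compmA qa compmA ri comp1m subrr.
(* The identity of [K] is a part through [L] plus a part through [c]. This gives the retraction, and
   it extends maps along [k] because [ext] handles the part through [L]. *)
have id_K : idm K = (b' \o a') - (h \o k).
  apply: (ses_mono s); rewrite compm1 compmBr !compmA kb' kh -compmA la'.
  by rewrite compmBl comp1m -compmA opprB addrC subrK.
split.
  have [T [i1 [i2 [p1 [p2 bT]]]]] := has_biprod L c.
  have [u [u1 u2]] := biprod_pair bT a' k.
  have [v [v1 v2]] := biprod_copair bT b' (- h).
  exists m.+1, T, u, v; split.
    case: bT => _ _ _ _ e; rewrite -[u]comp1m -e compmDl -!compmA u1 u2.
    by rewrite compmDr !compmA v1 v2 id_K compNm.
  exact: fin_res_biprod subX bT (fin_res_sub cogW.1 fL) Xc.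
move=> D f YD; have [g gl] := ext _ (f \o b') YD.
exists ((g \o a) - (f \o h)); rewrite compmBl -compmA -la' compmA gl.
by rewrite -!compmA -compmBr -id_K compm1.
Qed.

(* Each syzygy of a proper X-resolution is again a retract of an object of
   finite X-dimension, so the previous lemma applies at every stage. *)
Lemma proper_res_hom_exact (a : nat -> A) (d : forall m, hom (a m.+1) (a m)) :
  exact_seq d -> (forall m, X (a m.+1)) -> (forall C, X C -> hom_exact d C) ->
  fin_res_retract (a 0) ->
  forall m D, Y D -> forall f : hom (a m.+1) D, f \o d m.+1 = 0 ->
  exists g, g \o d m = f.
Proof.
move=> [e0 ex] Xa pa fa m.
have [T [p [j [mj ep jp [pp fT ext]]]]] : exists T (p : hom (a m.+1) T)
    (j : hom T (a m)), [/\ mono j, epi p, j \o p = d m &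
    [/\ precover p, fin_res_retract T
      & forall D (f : hom T D), Y D -> exists g, g \o j = f]].
  elim: m => [|m [T [p [j [mj ep jp [pp fT ext]]]]]].
    exists (a 0%N), (d 0%N), (idm _).
    split=> //; [exact: mono_idm|by rewrite comp1m|split=> //].
      by move=> C XC f; apply: (pa C XC).1.
    by move=> D f _; exists f; rewrite compm1.
  have [K [k [q [s kk kq eq]]]] := exact_seq_syzygy (ex m) mj ep jp.
  have [fK extK] := fin_res_retract_syzygy fT s (Xa m) pp.
  exists K, q, k; split=> //; first exact: ses_mono s.
  split=> // C XC f.
  have [|g gf] := (pa C XC).2 m (k \o f).
    by rewrite compmA kk.1 comp0m.
  by exists g; apply: (ses_mono s); rewrite compmA kq.
move=> D YD f fd.
have [K [k [q [s kk kq eq]]]] := exact_seq_syzygy (ex m) mj ep jp.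
(* A cocycle vanishes on the syzygy [K], so it descends to the image [T] of [d m] and extends from
   there along [j]. *)
have /(ses_desc s) [g gp] : f \o k = 0.
  by apply: (epi0P q).1 => //; rewrite -compmA kq.
by have [h hj] := ext _ g YD; exists h; rewrite -jp compmA hj.
Qed.

End OneSided.

(** * Balance *)

Section Subquotients.
Variables (U V W : zmodType) (f : {additive U -> V}) (g : {additive V -> W}).

Fact zcycle_subproof (z : V) : g z = 0 -> z \in ker_pred g.
Proof. by move=> /eqP. Qed.

Definition subquot_class (z : V) (gz : g z = 0) : subquot f g :=
  \pi_(subquot f g) (ZCycle (zcycle_subproof gz)).

Lemma subquot_classP (q : subquot f g) : exists z (gz : g z = 0),
  q = subquot_class gz.
Proof.
elim/quotW: q => -[z kz]; exists z; have gz : g z = 0 by apply/eqP.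
by exists gz; congr (\pi _); apply: val_inj.
Qed.

Lemma subquot_class_eq z z' (gz : g z = 0) (gz' : g z' = 0) :
  subquot_class gz = subquot_class gz' <-> exists x, f x = z - z'.
Proof.
split=> [/eqP|[x fx]]; last apply/eqP.
  by rewrite -Quotient.idealrBE => /asboolP.
by rewrite -Quotient.idealrBE; apply/asboolP; exists x.
Qed.

Lemma subquot_classB z z' (gz : g z = 0) (gz' : g z' = 0) (gB : g (z - z') = 0) :
  subquot_class gz - subquot_class gz' = subquot_class gB.
Proof.
by rewrite /subquot_class -raddfB; congr (\pi _); apply: val_inj.
Qed.

End Subquotients.

(* Isomorphism of the subquotients ZU/BU and ZV/BV, given by an additive
   correspondence instead of a map. *)
Definition subquot_rel (U V : zmodType) (ZU BU : U -> Prop) (ZV BV : V -> Prop) :=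
  exists R : U -> V -> Prop,
    [/\ forall u v, R u v -> ZU u /\ ZV v,
        forall u u' v v', R u v -> R u' v' -> R (u - u') (v - v'),
        forall u, ZU u -> exists v, R u v,
        forall v, ZV v -> exists u, R u v
      & forall u v, R u v -> BU u <-> BV v].

Lemma subquot_rel_sym (U V : zmodType) (ZU BU : U -> Prop) (ZV BV : V -> Prop) :
  subquot_rel ZU BU ZV BV -> subquot_rel ZV BV ZU BU.
Proof.
move=> [R [RZ RB RU RV RE]]; exists (fun v u => R u v); split=> //.
- by move=> v u /RZ [].
- by move=> *; apply: RB.
by move=> v u Ruv; have [] := RE u v Ruv.
Qed.

Lemma subquot_rel_trans (U V T : zmodType) (ZU BU : U -> Prop)
    (ZV BV : V -> Prop) (ZT BT : T -> Prop) :
  subquot_rel ZU BU ZV BV -> subquot_rel ZV BV ZT BT -> subquot_rel ZU BU ZT BT.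
Proof.
move=> [R [RZ RB RU RV RE]] [S [SZ SB SV ST SE]].
exists (fun u t => exists2 v, R u v & S v t); split.
- by move=> u t [v /RZ [? _] /SZ [_]].
- move=> u u' t t' [v Ruv Svt] [v' Ruv' Svt'].
  by exists (v - v'); [apply: RB|apply: SB].
- move=> u /RU [v Ruv]; have [_ /SV [t Svt]] := RZ _ _ Ruv.
  by exists t, v.
- move=> t /ST [v Svt]; have [/RV [u Ruv] _] := SZ _ _ Svt.
  by exists u, v.
by move=> u t [v /RE -> /SE].
Qed.

(** The induced relation [S] on the quotients is additive, total on both sides, and relates zero
    only to zero. It is therefore the graph of a bijection, which choice turns into a map. *)
Lemma zmod_iso_subquot (U V W U' V' W' : zmodType) (f : {additive U -> V})
    (g : {additive V -> W}) (f' : {additive U' -> V'}) (g' : {additive V' -> W'}) :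
  subquot_rel (fun z => g z = 0) (fun z => exists x, f x = z)
    (fun z => g' z = 0) (fun z => exists x, f' x = z) ->
  zmod_iso (subquot f g) (subquot f' g').
Proof.
move=> [R [RZ RB RU RV RE]].
pose S q q' := exists z (gz : g z = 0) z' (gz' : g' z' = 0),
  [/\ q = subquot_class f gz, q' = subquot_class f' gz' & R z z'].
have SB q1 q2 q1' q2' : S q1 q1' -> S q2 q2' -> S (q1 - q2) (q1' - q2').
  move=> [z1 [h1 [z1' [h1' [-> -> R1]]]]] [z2 [h2 [z2' [h2' [-> -> R2]]]]].
  have h : g (z1 - z2) = 0 by rewrite raddfB h1 h2 subr0.
  have h' : g' (z1' - z2') = 0 by rewrite raddfB h1' h2' subr0.
  exists (z1 - z2), h, (z1' - z2'), h'; split; last exact: RB.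
    exact: subquot_classB.
  exact: subquot_classB.
have S0 q q' : S q q' -> (q = 0 <-> q' = 0).
  move=> [z [h [z' [h' [-> -> Rzz']]]]].
  have g0 : g 0 = 0 by rewrite raddf0.
  have g'0 : g' 0 = 0 by rewrite raddf0.
  have e0 : subquot_class f g0 = 0.
    by rewrite /subquot_class -[RHS](raddf0 (\pi_(subquot f g))); congr (\pi _);
      apply: val_inj.
  have e0' : subquot_class f' g'0 = 0.
    by rewrite /subquot_class -[RHS](raddf0 (\pi_(subquot f' g'))); congr (\pi _);
      apply: val_inj.
  rewrite -e0 -e0' !subquot_class_eq !subr0.
  exact: RE.
have SU q : exists q', S q q'.
  have [z [h ->]] := subquot_classP q; have [z' Rz] := RU _ h.
  have [_ h'] := RZ _ _ Rz.
  by exists (subquot_class f' h'), z, h, z', h'.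
have SV q' : exists q, S q q'.
  have [z' [h' ->]] := subquot_classP q'; have [z Rz] := RV _ h'.
  have [h _] := RZ _ _ Rz.
  by exists (subquot_class f h), z, h, z', h'.
have [F SF] := choice SU; have [G SG] := choice SV.
have Fq q q' : S q q' -> F q = q'.
  move=> Sqq'; apply/eqP; rewrite -subr_eq0; apply/eqP.
  by have /S0 [<- //] := SB _ _ _ _ (SF q) Sqq'; rewrite subrr.
have Gq q q' : S q q' -> G q' = q.
  move=> Sqq'; apply/eqP; rewrite -subr_eq0; apply/eqP.
  by have /S0 [_ -> //] := SB _ _ _ _ (SG q') Sqq'; rewrite subrr.
have Fadd : zmod_morphism F by move=> q r; apply: Fq; apply: SB; apply: SF.
pose FA := GRing.isZmodMorphism.Build _ _ F Fadd.
pose F' : {additive subquot f g -> subquot f' g'} := HB.pack F FA.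
by exists F', G => q; [apply: Gq; apply: SF|apply: Fq; apply: SG].
Qed.

Section ZComplexes.
Variable C : zcplx.

(** Quantifying over all degrees changes nothing, as the other differentials vanish, and it avoids
    casts between [n - 1 + 1] and [n]. *)
Definition zcyc n (x : C n) := forall k, zdiff C n k x = 0.
Definition zbnd n (x : C n) := exists i (y : C i), zdiff C i n y = x.

Lemma zcycE n (x : C n) : zcyc x <-> zdiff C n (n - 1) x = 0.
Proof.
split=> [//|dx k]; case: (eqVneq n (k + 1)) => [nk|]; last by move=> /zdiff_shape ->.
by have -> : k = n - 1 by rewrite nk addrK.
Qed.

Lemma zbndE n (x : C n) : zbnd x <-> exists y, zdiff C (n + 1) n y = x.
Proof.
split=> [[i [y dy]]|[y dy]]; last by exists (n + 1), y.
have [e|ni] := eqVneq i (n + 1); first by move: y dy; rewrite e => y dy; exists y.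
by exists 0; rewrite raddf0 -dy zdiff_shape.
Qed.

Lemma zhomology_zeroP n :
  zmod_zero (zhomology C n) <-> forall x : C n, zcyc x -> zbnd x.
Proof.
have d0 : zdiff C n (n - 1) 0 = 0 by rewrite raddf0.
split=> [z x /zcycE dx|H q].
  apply/zbndE; rewrite -[x]subr0; apply/(subquot_class_eq _ dx d0).
  by rewrite [LHS]z [RHS]z.
have [x [dx ->]] := subquot_classP q.
have [y [dy ->]] := subquot_classP (0 : zhomology C n).
apply/subquot_class_eq/zbndE/H/zcycE.
by rewrite raddfB dx dy subr0.
Qed.

End ZComplexes.

Lemma zmod_iso_zhomology (C C' : zcplx) n n' :
  subquot_rel (@zcyc C n) (@zbnd C n) (@zcyc C' n') (@zbnd C' n') ->
  zmod_iso (zhomology C n) (zhomology C' n').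
Proof.
move=> [R [RZ RB RU RV RE]]; apply: zmod_iso_subquot; exists R; split=> //.
- by move=> x y /RZ [/zcycE ? /zcycE ?].
- by move=> x /zcycE /RU.
- by move=> x /zcycE /RV.
by move=> x y /RE; rewrite !zbndE.
Qed.

Section Balance.
Variables (A : preaddCat) (a b : nat -> A).
Variables (d : forall m, hom (a m.+1) (a m)) (e : forall m, hom (b m) (b m.+1)).
Hypothesis dK : forall m, d m \o d m.+1 = 0.
Hypothesis eK : forall m, e m.+1 \o e m = 0.
Hypothesis row_inj : forall j (f : hom (a 0) (b j.+1)), f \o d 0 = 0 -> f = 0.
Hypothesis row_exact : forall j m (f : hom (a m.+1) (b j.+1)),
  f \o d m.+1 = 0 -> exists g, g \o d m = f.
Hypothesis col_inj : forall i (f : hom (a i.+1) (b 0)), e 0 \o f = 0 -> f = 0.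
Hypothesis col_exact : forall i m (f : hom (a i.+1) (b m.+1)),
  e m.+1 \o f = 0 -> exists g, e m \o g = f.

(** Taken modulo [bibnd], these subquotients are isomorphic along each antidiagonal and interpolate
    between the two cohomology groups, which sit beyond its ends. *)
Let bicyc i j (z : hom (a i.+1) (b j.+1)) := z \o d i.+1 = 0 /\ e j.+1 \o z = 0.
(* The augmentations sit at index 0 of [a] and [b]; the condition at [i + j = 0]
   discards the corner Hom(a_0, b_0), which is not part of the bicomplex. *)
Let bibnd i j (z : hom (a i.+1) (b j.+1)) :=
  exists w : hom (a i) (b j), ((i + j)%N = 0%N -> w = 0) /\ e j \o w \o d i = z.

Let left_rel m : subquot_rel (fun x : hom (a m.+1) (b 0) => x \o d m.+1 = 0)
  (fun x => exists w : hom (a m) (b 0), (m = 0%N -> w = 0) /\ w \o d m = x)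
  (@bicyc m 0) (@bibnd m 0).
Proof.
exists (fun x z => x \o d m.+1 = 0 /\ e 0 \o x = z); split.
- by move=> x z [xd <-]; split=> //; split; rewrite -?compmA ?xd ?compm0 // compmA
    eK comp0m.
- move=> x x' z z' [xd <-] [xd' <-]; split; last by rewrite compmBr.
  by rewrite compmBl xd xd' subrr.
- by move=> x xd; exists (e 0%N \o x).
- move=> z [zd /col_exact [x xz]]; exists x; split=> //.
  by apply: col_inj; rewrite compmA xz.
move=> x z [xd <-]; split=> -[w [w0 wd]]; exists w; split.
- by rewrite addn0.
- by rewrite -compmA wd.
- by move=> m0; apply: w0; rewrite addn0.
apply/eqP; rewrite -subr_eq0; apply/eqP/col_inj.
by rewrite compmBr compmA wd subrr.
Qed.

Let right_rel m : subquot_rel (@bicyc 0 m) (@bibnd 0 m)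
  (fun y : hom (a 0) (b m.+1) => e m.+1 \o y = 0)
  (fun y => exists w : hom (a 0) (b m), (m = 0%N -> w = 0) /\ e m \o w = y).
Proof.
apply: subquot_rel_sym.
exists (fun y z => e m.+1 \o y = 0 /\ y \o d 0 = z); split.
- by move=> y z [ey <-]; split=> //; split; rewrite ?compmA ?ey ?comp0m // -compmA
    dK compm0.
- move=> y y' z z' [ey <-] [ey' <-]; split; last by rewrite compmBl.
  by rewrite compmBr ey ey' subrr.
- by move=> y ey; exists (y \o d 0).
- move=> z [/row_exact [y yz] ez]; exists y; split=> //.
  by apply: row_inj; rewrite -compmA yz.
move=> y z [ey <-]; split=> -[w [w0 we]]; exists w; split.
- by rewrite add0n.
- by rewrite we.
- by move=> m0; apply: w0; rewrite add0n.
apply/eqP; rewrite -subr_eq0; apply/eqP/row_inj.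
by rewrite compmBl we subrr.
Qed.

(** One step of the staircase: [z] and [z'] are the images of one [x] under the two differentials.
    If [z] bounds through [w], then [x - (e j \o w)] is a row cocycle, so it comes from some [y]
    through which [z'] bounds; columns give the converse. The index sum is positive here, so the
    corner condition is void. *)
Let step_rel i j : subquot_rel (@bicyc i.+1 j) (@bibnd i.+1 j)
  (@bicyc i j.+1) (@bibnd i j.+1).
Proof.
exists (fun z z' => exists x : hom (a i.+1) (b j.+1),
  [/\ e j.+1 \o x \o d i.+1 = 0, x \o d i.+1 = z & e j.+1 \o x = z']); split.
- move=> z z' [x [exd <- <-]]; split; split=> //; rewrite ?compmA //.
    by rewrite -compmA dK compm0.
  by rewrite eK comp0m.
- move=> z1 z2 z1' z2' [x [exd <- <-]] [x' [exd' <- <-]]; exists (x - x').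
  by rewrite !(compmBr, compmBl) exd exd' subrr.
- move=> z [/row_exact [x xz] ez]; exists (e j.+1 \o x), x; split=> //.
  by rewrite -compmA xz.
- move=> z' [z'd /col_exact [x xz]]; exists (x \o d i.+1), x; split=> //.
  by rewrite xz.
move=> z z' [x [exd <- <-]]; split=> -[w [_ wz]].
  have /row_exact [y yd] : (x - (e j \o w)) \o d i.+1 = 0.
    by rewrite compmBl wz subrr.
  exists y; split; first by rewrite addnS.
  by rewrite -compmA yd compmBr compmA eK comp0m subr0.
have /col_exact [y ey] : e j.+1 \o (x - (w \o d i)) = 0.
  by rewrite compmBr compmA wz subrr.
exists y; split; first by rewrite addSn.
by rewrite ey compmBl -compmA dK compm0 subr0.
Qed.

Lemma balance m :
  subquot_rel (fun x : hom (a m.+1) (b 0) => x \o d m.+1 = 0)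
    (fun x => exists w : hom (a m) (b 0), (m = 0%N -> w = 0) /\ w \o d m = x)
    (fun y : hom (a 0) (b m.+1) => e m.+1 \o y = 0)
    (fun y => exists w : hom (a 0) (b m), (m = 0%N -> w = 0) /\ e m \o w = y).
Proof.
apply: subquot_rel_trans (@left_rel m) _.
suff gen i j : (i + j)%N = m -> subquot_rel (@bicyc i j) (@bibnd i j)
    (fun y : hom (a 0) (b m.+1) => e m.+1 \o y = 0)
    (fun y => exists w : hom (a 0) (b m), (m = 0%N -> w = 0) /\ e m \o w = y).
  by apply: gen; rewrite addn0.
elim: i j => [|i IHi] j; first by rewrite add0n => ->; apply: right_rel.
rewrite addSnnS => /IHi; apply: subquot_rel_trans; exact: step_rel.
Qed.

End Balance.

(** * Complexes indexed by int and sequences indexed by nat *)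

Lemma intS_eq (i j : nat) : (Posz i == Posz j + 1) = (i == j.+1).
Proof. by rewrite -PoszD addn1. Qed.

Lemma opp_intS_eq (i j : nat) : (- Posz i == - Posz j + 1) = (j == i.+1).
Proof.
rewrite -(inj_eq (@oppr_inj _)) opprD !opprK eq_sym subr_eq.
exact: intS_eq.
Qed.

Section HomologyExactness.
Variables (A : abelianCat) (C : cplx A).

(** The neighbouring degrees are variables subject to equations, so that the lemma applies where
    they are not syntactically [n + 1] and [n - 1]. *)
Lemma homology_zeroE n i j : i = n + 1 -> j = n - 1 ->
  homology_zero C n <-> exact_at (diff C i n) (diff C n j).
Proof.
move=> -> ->; split=> [[K [H [k [p [[kk [u [ku pu]]] zH]]]]]|[K [k [u [kk ku eu]]]]].
  exists K, k, u; split=> //; apply/epi0P => z g gu.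
  have [v <-] := cokernel_desc pu gu.
  by rewrite (zH.2 _ v) comp0m.
exists K, (zero_ob A), k, 0; split; last exact: zero_obP.
split=> //; exists u; split=> //; apply: cokernel_intro.
- by move=> c g h _; rewrite ((zero_obP A).2 _ g) ((zero_obP A).2 _ h).
- by rewrite comp0m.
by move=> c g /((epi0P u).1 eu) ->; exists 0; rewrite comp0m.
Qed.

End HomologyExactness.

Section HomComplexes.
Variables (A : abelianCat) (C : cplx A) (N : A).

Definition cocyc n (x : hom (C n) N) :=
  forall k, x \o diff C k n = 0.
Definition cobnd n (x : hom (C n) N) :=
  exists i (y : hom (C i) N), y \o diff C n i = x.

Lemma zcyc_hom_from n (x : hom_from C N n) : zcyc x <-> cocyc x.
Proof. by split=> H k; [rewrite -(opprK k)|]; apply: H. Qed.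

Lemma zbnd_hom_from n (x : hom_from C N n) : zbnd x <-> cobnd x.
Proof.
split=> -[i [y yx]]; first by exists (- i), y.
by move: y yx; rewrite -(opprK i) => y yx; exists (- i), y.
Qed.

Lemma zexact_hom_fromP :
  zexact (hom_from C N) <-> forall n (x : hom (C n) N), cocyc x -> cobnd x.
Proof.
split=> H n; last first.
  by apply/zhomology_zeroP => x /zcyc_hom_from /H /zbnd_hom_from.
rewrite -(opprK n) => x; have /zhomology_zeroP /(_ x) h := H (- n).
by move=> /zcyc_hom_from /h /zbnd_hom_from.
Qed.

(** Degree [- n] of [hom_from C N] consists of maps out of [C (- - n)]; whole statements are
    transported along [opprK], never single elements. *)
Lemma subquot_rel_hom_from n (V : zmodType) (ZV BV : V -> Prop) :
  subquot_rel (@cocyc n) (@cobnd n) ZV BV ->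
  subquot_rel (@zcyc (hom_from C N) (- n)) (@zbnd (hom_from C N) (- n)) ZV BV.
Proof.
have -> : @zcyc (hom_from C N) (- n) = @cocyc (- - n).
  by apply/funext => x; apply/propext/zcyc_hom_from.
have -> : @zbnd (hom_from C N) (- n) = @cobnd (- - n).
  by apply/funext => x; apply/propext/zbnd_hom_from.
move=> H; have : subquot_rel (@cocyc (- - n)) (@cobnd (- - n)) ZV BV.
  by rewrite opprK.
exact.
Qed.

End HomComplexes.

Section ResolutionSequence.
Variables (A : abelianCat) (P : A -> Prop) (M : A) (C : resolution P M).

(* The augmented sequence is shifted: M is at index 0 and C_m at index m + 1. *)
Definition res_ob m : A := if m is m'.+1 then C (Posz m') else M.

Definition res_diff m : hom (res_ob m.+1) (res_ob m) :=
  match m with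
  | 0 => res_aug C
  | m'.+1 => diff C (Posz m'.+1) (Posz m')
  end.

(** As C_(-1) is zero, the kernel [k] of C_0 -> C_(-1) is invertible, which turns the homology
    projection into a cokernel of C_1 -> C_0. *)
Lemma res_aug_cokernel : is_cokernel (diff C 1 0) (res_aug C).
Proof.
have [K [k [p [[kk [u [ku pu]]] ap]]]] := res_augP C.
have d0 : diff C 0 (0 - 1) \o idm (C 0) = 0.
  by rewrite compm1; apply: (@res_neg _ _ _ C (0 - 1) _).1.
have [s ks] := kernel_lift kk d0.
have sk : s \o k = idm K by apply: (kernel_mono kk); rewrite compmA ks comp1m compm1.
have aE : res_aug C = p \o s by rewrite -ap -compmA ks compm1.
apply: cokernel_intro.
- apply: (@epi_compl _ _ _ _ _ k); rewrite ap; exact: cokernel_epi pu.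
- exact: res_aug_diff.
move=> z g; rewrite -[diff C 1 0]ku compmA => /(cokernel_desc pu) [v vp].
by exists v; rewrite aE compmA vp -compmA ks compm1.
Qed.

Lemma res_exact_seq : exact_seq res_diff.
Proof.
split; first exact: cokernel_epi res_aug_cokernel.
case=> [|m]; first exact: cokernel_kernel_exact res_aug_cokernel.
apply/(homology_zeroE C (n := Posz m.+1)); last exact: res_acyclic.
  by apply/eqP; rewrite intS_eq.
by rewrite -addn1 PoszD addrK.
Qed.

Lemma res_properP N : zexact (hom_to N (aug C)) <-> hom_exact res_diff N.
Proof.
split=> [ex|[H0 HS] n].
  have {}ex n := (zhomology_zeroP _ n).1 (ex n).
  split=> [f|m f df].
    have [[k|[|k]]|i [y dy]] := ex (Negz 0) f; try exact: comp0m.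
    case: i y dy => [[|i]|[|i]] y dy; first by exists y.
    - by exists 0; rewrite compm0 -dy; apply/esym/comp0m.
    - by exists 0; rewrite compm0 -dy; apply/esym/comp0m.
    by exists 0; rewrite compm0 -dy; apply/esym/comp0m.
  have [k|i [y dy]] := ex (Posz m) f.
    case: k => [k|[|k]]; last exact: comp0m.
      rewrite /= /postc; case: (eqVneq m k.+1) => [e|mk].
        by move: f df; rewrite e.
      by rewrite diff_shape ?comp0m // intS_eq.
    by case: m f df => //= m f df; apply: comp0m.
  case: i y dy => [i|i] y dy; last first.
    by exists 0; rewrite compm0 -dy; apply/esym/comp0m.
  rewrite /= /postc in dy; case: (eqVneq i m.+1) => [e|im].
    by move: y dy; rewrite e => y dy; exists y.
  by exists 0; rewrite compm0 -dy diff_shape ?comp0m // intS_eq.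
apply/zhomology_zeroP; case: n => [m|[|m]] f cf.
- have [|g gf] := HS m f; last by exists (Posz m.+1), g.
  case: m f cf => [|m] f cf; first exact: (cf (Negz 0)).
  exact: (cf (Posz m)).
- by have [g gf] := H0 f; exists (Posz 0), g.
exists (Negz m), 0; rewrite raddf0; apply/esym.
exact: (zero_obP A).1.
Qed.

Lemma cocyc_res N m (x : hom (C (Posz m)) N) :
  cocyc x <-> x \o res_diff m.+1 = 0.
Proof.
split=> [cx|cx [k|k]]; first exact: cx; last first.
  suff -> : diff C (Negz k) (Posz m) = 0 by apply: compm0.
  exact: (@res_neg _ _ _ C (Negz k) _).2.
case: (eqVneq k m.+1) => [->|km]; first exact: cx.
by rewrite diff_shape ?compm0 // intS_eq.
Qed.

(** C_(-1) is zero, whereas index 0 of the augmented sequence holds [M]; the condition at [m = 0]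
    excludes maps that come from the augmentation. *)
Lemma cobnd_res N m (x : hom (C (Posz m)) N) : cobnd x <->
  exists w : hom (res_ob m) N, (m = 0%N -> w = 0) /\ w \o res_diff m = x.
Proof.
split=> [[i [y yx]]|[w [w0 wx]]]; last first.
  case: m x w w0 wx => [|m] x w w0 wx.
    by exists 0, 0; rewrite comp0m -wx w0 // comp0m.
  by exists (Posz m), w.
case: m x yx => [|m] x yx.
  exists 0; split=> //; rewrite comp0m -yx.
  case: i y yx => [i|i] y yx.
    by rewrite diff_shape ?compm0 // intS_eq.
  by rewrite ((@res_neg _ _ _ C (Negz i) _).2 _ y) // comp0m.
case: i y yx => [i|i] y yx.
  have [e|ni] := eqVneq m i.
    by move: y yx; rewrite -e => y yx; exists y.
  by exists 0; split=> //; rewrite comp0m -yx diff_shape ?compm0 // intS_eq eqSS.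
exists 0; split=> //; rewrite comp0m -yx.
by rewrite ((@res_neg _ _ _ C (Negz i) _).2 _ y) // comp0m.
Qed.

End ResolutionSequence.

Section CoresolutionSequence.
Variables (A : abelianCat) (P : A -> Prop) (N : A) (D : coresolution P N).

Definition cores_ob m : A := if m is m'.+1 then D (- Posz m') else N.

Definition cores_diff m : hom (cores_ob m) (cores_ob m.+1) :=
  match m with
  | 0 => cores_aug D
  | m'.+1 => diff D (- Posz m') (- Posz m'.+1)
  end.

Lemma cores_aug_kernel : is_kernel (diff D 0 (-1)) (cores_aug D).
Proof.
have [K [k [p [[kk [u [ku pu]]] ap]]]] := cores_augP D.
have u0 : idm K \o u = 0.
  by rewrite comp1m; apply: (@cores_pos _ _ _ D (0 + 1) _).2.
have [s sp] := cokernel_desc pu u0.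
have ps : p \o s = idm N.
  by apply: (cokernel_epi pu); rewrite -compmA sp comp1m compm1.
have aE : cores_aug D = k \o s by rewrite -ap -compmA ps compm1.
apply: kernel_intro.
- rewrite aE; apply: mono_comp; first exact: kernel_mono kk.
  by apply: (@mono_compr _ _ _ _ p); rewrite ps; apply: mono_idm.
- exact: cores_diff_aug.
move=> z g /(kernel_lift kk) [v kv].
by exists (p \o v); rewrite aE compmA -[(k \o s) \o p]compmA sp compm1.
Qed.

Lemma cores_exact_seq : @exact_seq (opp A) cores_ob cores_diff.
Proof.
split; first exact: kernel_mono cores_aug_kernel.
case=> [|m]; apply: opp_exact_at.
  exists N, (cores_aug D), (idm N); rewrite compm1; split=> //.
    exact: cores_aug_kernel.
  exact: epi_idm.
apply/(homology_zeroE D (n := - Posz m.+1)); last exact: cores_acyclic.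
  by apply/eqP; rewrite opp_intS_eq.
by apply/eqP; rewrite eq_sym subr_eq opp_intS_eq.
Qed.

Lemma cores_shape i j : j != i.+1 -> diff D (- Posz i) (- Posz j) = 0.
Proof. by move=> ij; rewrite diff_shape // opp_intS_eq. Qed.

Lemma zcyc_cores M m (x : hom M (D (- Posz m))) :
  @zcyc (hom_to M D) _ x <-> cores_diff m.+1 \o x = 0.
Proof.
split=> [cx|cx k]; first exact: cx.
rewrite -(opprK k); case: (- k) => [{}k|{}k]; rewrite /= /postc.
  case: (eqVneq k m.+1) => [->|km]; first exact: cx.
  by rewrite cores_shape ?comp0m.
have -> : diff D (- Posz m) (- Negz k) = 0; last exact: comp0m.
by apply: (@cores_pos _ _ _ D (- Negz k) _).1.
Qed.

Lemma zbnd_cores M m (x : hom M (D (- Posz m))) :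
  @zbnd (hom_to M D) _ x <->
  exists w : hom M (cores_ob m), (m = 0%N -> w = 0) /\ cores_diff m \o w = x.
Proof.
split=> [[i [y]]|[w [w0 wx]]]; last first.
  case: m x w w0 wx => [|m] x w w0 wx.
    by exists 0, 0; rewrite raddf0 -wx w0 // compm0.
  by exists (- Posz m), w.
have zpos k : is_zero (D (- Negz k)) by apply: (@cores_pos _ _ _ D).
move: y; rewrite -(opprK i); case: (- i) => [{}i|{}i] y; rewrite /= /postc => yx.
  case: m x yx => [|m] x yx.
    by exists 0; split=> //; rewrite compm0 -yx cores_shape ?comp0m.
  have [e|ni] := eqVneq m i.
    by move: y yx; rewrite -e => y yx; exists y.
  by exists 0; split=> //; rewrite compm0 -yx cores_shape ?comp0m // eqSS.
exists 0; split=> //; rewrite compm0 -yx ((zpos i).1 _ y).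
by rewrite compm0.
Qed.

Lemma cores_properP C :
  zexact (hom_from (coaug D) C) <-> @hom_exact (opp A) cores_ob cores_diff C.
Proof.
have shape i j : j != i.+1 -> diff D (- Posz i) (- Posz j) = 0.
  exact: cores_shape.
rewrite zexact_hom_fromP; split=> [ex|[H0 HS]].
  have pre0 a b c (f : hom b c) (h : hom a b) : h = 0 -> f \o h = 0.
    by move=> ->; apply: compm0.
  have post0 (a b c : A) (f : hom a b) (y : hom c b) (h : hom a c) :
      y \o h = f -> h = 0 -> f = 0.
    by move=> <- ->; apply: compm0.
  split=> [f|m f df].
    have [k|i [y yd]] := ex (Posz 1) f.
      by case: k => [[|[|k]]|k]; apply: compm0.
    case: i y yd => [[|i]|i] y yd; first by exists y.
    - by exists 0; rewrite compm0; rewrite (post0 _ _ _ _ _ _ yd).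
    by exists 0; rewrite compm0; rewrite (post0 _ _ _ _ _ _ yd).
  case: m f df => [|m] f df.
    have [k|i [y yd]] := ex (Posz 0) f.
      case: k => [[|[|k]]|k]; [|exact: df|exact: compm0|].
        by apply: pre0; apply: (shape 0%N 0%N).
      by apply: pre0; apply: (shape k.+1 0%N).
    case: i y yd => [[|i]|[|i]] y yd; last 1 first.
    - exists 0; rewrite compm0 (post0 _ _ _ _ _ _ yd) //.
      exact: (shape 0%N i.+2).
    - exists 0; rewrite compm0 (post0 _ _ _ _ _ _ yd) //.
      exact: (shape 0%N 0%N).
    - by exists 0; rewrite compm0 (post0 _ _ _ _ _ _ yd).
    by exists y.
  have [k|i [y yd]] := ex (Negz m) f.
    case: k => [[|[|k]]|k]; [|exact: compm0|exact: compm0|].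
      case: m f df => [|m] f df; first exact: df.
      by apply: pre0; apply: (shape 0%N m.+2).
    case: (eqVneq m k.+1) => [e|mk].
      by move: f df; rewrite e.
    by apply: pre0; apply: (shape k.+1 m.+1).
  case: i y yd => [[|i]|i] y yd.
  - exists 0; rewrite compm0 (post0 _ _ _ _ _ _ yd) //.
    exact: (shape m.+1 0%N).
  - by exists 0; rewrite compm0 (post0 _ _ _ _ _ _ yd).
  case: (eqVneq i m.+1) => [e|im].
    by move: y yd; rewrite e => y yd; exists y.
  exists 0; rewrite compm0 (post0 _ _ _ _ _ _ yd) //.
  exact: (shape m.+1 i.+1).
case=> [[|[|n]]|m] x cx.
- have [|g gx] := HS 0%N x; first exact: (cx (Posz 1)).
  by exists (Negz 0), g.
- by have [g gx] := H0 x; exists (Posz 0), g.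
- by exists (Posz 0), 0; rewrite comp0m; apply/esym/(zero_obP A).2.
have [|g gx] := HS m.+1 x; last by exists (Negz m.+1), g.
case: m x cx => [|m] x cx; first exact: (cx (Posz 0)).
exact: (cx (Negz m)).
Qed.

End CoresolutionSequence.

(** * Construction of proper resolutions from syzygies *)

Section SequenceComplex.
Variables (A : abelianCat) (c : nat -> A) (d : forall m, hom (c m.+1) (c m)).
Hypothesis dK : forall m, d m \o d m.+1 = 0.

Definition seq_ob (n : int) : A := if n is Posz m then c m else zero_ob A.

(** The cast follows a decidable equality of naturals, whose proofs are unique, so it disappears at
    consecutive degrees. *)
Definition nat_diff (i j : nat) : hom (c i) (c j) :=
  match @eqP _ i j.+1 with
  | ReflectT e => ecast l (hom (c l) (c j)) (esym e) (d j)
  | ReflectF _ => 0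
  end.

Lemma nat_diffE m : nat_diff m.+1 m = d m.
Proof.
by rewrite /nat_diff; case: eqP => // e; rewrite (eq_irrelevance e erefl).
Qed.

Lemma nat_diff0 i j : i != j.+1 -> nat_diff i j = 0.
Proof. by rewrite /nat_diff; case: eqP. Qed.

Definition seq_diff (i j : int) : hom (seq_ob i) (seq_ob j) :=
  match i, j with
  | Posz i, Posz j => nat_diff i j
  | _, _ => 0
  end.

Fact seq_diff_shape i j : i != j + 1 -> seq_diff i j = 0.
Proof. by case: i j => [i|i] [j|j] //; rewrite intS_eq; apply: nat_diff0. Qed.

Fact seq_diffK i j k : seq_diff j k \o seq_diff i j = 0.
Proof.
case: i j k => [i|i] [j|j] [k|k]; rewrite ?comp0m ?compm0 //=.
have [->|/nat_diff0 ->] := eqVneq i j.+1; last exact: compm0.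
have [->|/nat_diff0 ->] := eqVneq j k.+1; last exact: comp0m.
by rewrite !nat_diffE.
Qed.

Definition seq_cplx : cplx A := Cplx seq_diff_shape seq_diffK.

Variables (P : A -> Prop) (M : A) (aug : hom (c 0) M).
Hypotheses (subP : subcategory P) (Pc : forall m, P (c m)).
Hypothesis aug_coker : is_cokernel (d 0) aug.
Hypothesis exact_d : forall m, exact_at (d m.+1) (d m).

Fact seq_resP n : P (seq_cplx n).
Proof. by case: n => [m|m]; [apply: Pc|apply: sub_zero]. Qed.

Fact seq_res_neg (n : int) : n < 0 -> is_zero (seq_cplx n).
Proof. by case: n => // m _; apply: zero_obP. Qed.

Fact seq_res_acyclic (n : int) : 0 < n -> homology_zero seq_cplx n.
Proof.
case: n => [[|m]|m] // _.
apply/(@homology_zeroE _ seq_cplx (Posz m.+1) (Posz m.+2) (Posz m)).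
- by apply/eqP; rewrite intS_eq.
- by rewrite -addn1 PoszD addrK.
by rewrite /= !nat_diffE.
Qed.

Fact seq_res_augP : exists K (k : hom K (seq_cplx 0)) (p : hom K M),
  is_homology k p /\ aug \o k = p.
Proof.
exists (c 0%N), (idm _), aug; rewrite compm1; split=> //; split.
  have -> : Defs.diff seq_cplx 0 (0 - 1) = 0 by [].
  by apply: kernel_intro;
    [apply: mono_idm|rewrite comp0m|move=> z g _; exists g; rewrite comp1m].
by exists (d 0%N); rewrite comp1m; split=> //; exact/esym/nat_diffE.
Qed.

Definition seq_resolution : resolution P M :=
  Resolution seq_resP seq_res_neg seq_res_acyclic seq_res_augP.

End SequenceComplex.

Section SyzygyResolution.
Variables (A : abelianCat) (P : A -> Prop).
Hypothesis subP : subcategory P.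

(* [o s] is the syzygy attached to the state [s]. *)
Lemma ex_proper_resolution (S : Type) (o : S -> A) (Q : S -> S -> A -> Prop) :
  (forall s, exists s' c (k : hom (o s') c) (p : hom c (o s)),
     [/\ is_ses k p, P c, precover P p & Q s s' c]) ->
  forall s0, exists (C : proper_resolution P (o s0)) (st : nat -> S),
    st 0 = s0 /\ forall m, Q (st m) (st m.+1) (C (Posz m)).
Proof.
move=> step s0.
have F1 s := cid (step s).
have F2 s := cid (svalP (F1 s)).
have F3 s := cid (svalP (F2 s)).
have F4 s := cid (svalP (F3 s)).
pose st m := iter m (fun s => sval (F1 s)) s0.
pose c m := sval (F2 (st m)).
pose k m : hom (o (st m.+1)) (c m) := sval (F3 (st m)).
pose p m : hom (c m) (o (st m)) := sval (F4 (st m)).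
have kpP m : [/\ is_ses (k m) (p m), P (c m), precover P (p m)
    & Q (st m) (st m.+1) (c m)] by apply: svalP (F4 (st m)).
pose d m := k m \o p m.+1.
have pk m : p m \o k m = 0 by case: (kpP m) => s _ _ _; apply: ses0 s.
have dK m : d m \o d m.+1 = 0.
  by rewrite /d compmA -[(k m \o p m.+1) \o k m.+1]compmA pk compm0 comp0m.
have kd m : is_kernel (d m) (k m.+1).
  case: (kpP m) (kpP m.+1) => s _ _ _ [s' _ _ _].
  by apply: kernel_post_mono (ses_mono s) s'.1.
have ep m : epi (p m) by case: (kpP m) => s _ _ _; apply: ses_epi s.
have ad : is_cokernel (d 0%N) (p 0%N).
  by apply: cokernel_pre_epi (ep 1%N) _; case: (kpP 0%N) => -[].
have ex m : exact_at (d m.+1) (d m).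
  by exists (o (st m.+2)), (k m.+1), (p m.+2).
have Pc m : P (c m) by case: (kpP m).
pose C := seq_resolution dK subP Pc ad ex.
have pC D : P D -> zexact (hom_to D (aug C)).
  move=> PD; apply/res_properP; split.
    by case: (kpP 0%N) => _ _ pr _ f; apply: pr.
  case=> [|m] f df.
    have s : is_ses (k 0%N) (p 0%N) by case: (kpP 0%N).
    have [f' kf'] := ses_lift s df.
    have [g pg] : exists g, p 1%N \o g = f'.
      by case: (kpP 1%N) => _ _ pr _; apply: pr.
    by exists g; rewrite /= nat_diffE /d -compmA pg kf'.
  rewrite /= nat_diffE in df.
  have [f' kf'] := kernel_lift (kd m) df.
  have [g pg] : exists g, p m.+2 \o g = f'.
    by case: (kpP m.+2) => _ _ pr _; apply: pr.
  by exists g; rewrite /= nat_diffE /d -compmA pg kf'.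
exists (ProperResolution pC), st; split=> // m.
by case: (kpP m).
Qed.

Lemma ex_proper_resolution_closed (Z : A -> Prop) :
  (forall T, Z T -> exists K c (k : hom K c) (p : hom c T),
     [/\ is_ses k p, P c, precover P p & Z K]) ->
  forall T, Z T -> inhabited (proper_resolution P T).
Proof.
move=> step T ZT.
have [|C _] := @ex_proper_resolution {T | Z T} sval (fun _ _ _ => True) _
  (exist _ T ZT); last exact: inhabits C.
move=> [{ZT}T ZT] /=; have [K [c [k [p [s Pc pp ZK]]]]] := step T ZT.
by exists (exist _ K ZK), c, k, p.
Qed.

(** Vanishing of Ext^1 against the syzygies makes each step of a finite resolution a precover. The
    state carries the remaining length along with the object, and this bounds the resolution. *)
Lemma ex_bounded_proper_resolution :
  (forall n C T, P C -> fin_res P n T -> ext1_zero C T) ->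
  forall n T, fin_res P n T -> exists C : proper_resolution P T,
    forall m, (n <= m)%N -> is_zero (C (Posz m)).
Proof.
move=> perpP n0 T0 f0.
pose S := {x : nat * A | fin_res P x.1 x.2}.
have [|C [st [st0 stS]]] := @ex_proper_resolution S (fun x => (sval x).2)
    (fun x y c => (sval y).1 = (sval x).1.-1 /\ ((sval x).1 = 0%N -> is_zero c)) _
    (exist _ (n0, T0) f0).
  move=> [[[|n] T] /= fT].
    (* At remaining length 0 the object [T] is zero and serves as its own term; the length stays 0,
       as does the truncated predecessor. *)
    exists (exist _ (0%N, zero_ob A) (zero_obP A)), T, 0, (idm T) => /=.
    split=> //; [exact: ses_zero_left (zero_obP A)|exact: subcategory_zero|].
    by move=> D _ f; exists f; rewrite comp1m.
  have [K [c [k [p [s Pc fK]]]]] := fT.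
  exists (exist _ (n, K) fK), c, k, p; split=> // D PD f.
  exact: ext1_lift (perpP _ _ _ PD fK) s.
exists C => m nm; have [_] := stS m; apply.
suff -> : (sval (st m)).1 = (n0 - m)%N by apply/eqP; rewrite subn_eq0.
elim: m {nm} => [|m IHm]; first by rewrite st0 subn0.
by have [-> _] := stS m; rewrite IHm subnS.
Qed.

End SyzygyResolution.

(** * Coresolutions from resolutions in the opposite category *)

Section OppositeResolution.
Variables (A : abelianCat) (P : A -> Prop) (N : A).

Section Coresolution.
Variable R : @resolution (opp A) P N.

Definition opp_diff (i j : int) : @hom A (R (- i)) (R (- j)) :=
  diff R (- j) (- i).

Fact opp_diff_shape i j : i != j + 1 -> opp_diff i j = 0.
Proof.
move=> ij; apply: (@Defs.diff_shape _ R (- j) (- i)).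
by apply: contra ij => /eqP e; rewrite -(opprK j) e opprD opprK addrNK.
Qed.

Fact opp_diffK i j k : @compm A _ _ _ (opp_diff j k) (opp_diff i j) = 0.
Proof. exact: (@diffK _ R). Qed.

Definition opp_cplx : cplx A := @Cplx A _ opp_diff opp_diff_shape opp_diffK.

Fact opp_cplxP n : P (opp_cplx n). Proof. exact: resP. Qed.

Fact opp_cplx_pos (n : int) : 0 < n -> is_zero (opp_cplx n).
Proof.
move=> n0; have := @res_neg _ _ _ R (- n); rewrite oppr_lt0 => /(_ n0).
by case.
Qed.

Fact opp_cplx_acyclic (n : int) : n < 0 -> homology_zero opp_cplx n.
Proof.
move=> n0; apply/(@homology_zeroE _ opp_cplx n) => //.
apply: (@opp_exact_at (opp A)).
apply/(@homology_zeroE _ R (- n)).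
- by rewrite opprB addrC.
- by rewrite opprD.
by apply: res_acyclic; rewrite oppr_gt0.
Qed.

Fact opp_cplx_augP : exists K (k : hom K (opp_cplx 0)) (p : hom K N),
  is_homology k p /\ (res_aug R : @hom A N (opp_cplx 0)) \o p = k.
Proof.
(* The augmentation is already a kernel of the differential from degree 0 to degree -1, and the term
   in degree 1 is zero, so the homology projection can be the identity of [N]. *)
exists N, (res_aug R), (idm N); rewrite compm1; split=> //; split.
  exact: (res_aug_cokernel R).
exists 0; split.
  rewrite compm0; apply/esym.
  by apply: (@opp_cplx_pos (0 + 1) _).2.
apply: cokernel_intro; [exact: epi_idm|exact: compm0|].
by move=> c g _; exists g; rewrite compm1.
Qed.

Definition opp_resolution : coresolution P N :=
  Coresolution opp_cplxP opp_cplx_pos opp_cplx_acyclic opp_cplx_augP.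

End Coresolution.

Lemma opp_proper_resolution (R : @proper_resolution (opp A) P N) :
  forall C, P C -> zexact (hom_from (coaug (opp_resolution R)) C).
Proof.
move=> C PC; apply/cores_properP.
have [H0 HS] := (res_properP R C).1 (@presP _ _ _ R C PC).
split=> [f|[|m] f df]; first exact: H0.
  exact: (HS 0%N f df).
case: m f df => [|m] f df; first exact: (HS 1%N f df).
exact: (HS m.+2 f df).
Qed.

End OppositeResolution.

(** * Comparison of the two relative Ext groups *)

Lemma subquot_rel_zero (U V : zmodType) (ZU BU : U -> Prop) (ZV BV : V -> Prop) :
  zmod_zero U -> zmod_zero V -> ZU 0 -> BU 0 -> ZV 0 -> BV 0 ->
  subquot_rel ZU BU ZV BV.
Proof.
move=> zU zV ZU0 BU0 ZV0 BV0; exists (fun _ _ => True); split=> //.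
- by move=> u v; rewrite (zU u) (zV v).
- by exists 0.
- by exists 0.
by move=> u v; rewrite (zU u) (zV v).
Qed.

Section Dimensions.
Variables (A : abelianCat) (P : A -> Prop).

Lemma pd_finite_fin_res M : pd_finite P M -> exists n, fin_res P n M.
Proof.
(* [fin_res] counts the terms C_0, ..., C_b. *)
move=> [b [C zC]]; exists b.+1.
apply: (exact_seq_fin_res (res_exact_seq C)) => [m|m bm]; first exact: resP.
exact: zC.
Qed.

Lemma id_finite_fin_res N : id_finite P N -> exists n, @fin_res (opp A) P n N.
Proof.
move=> [b [D zD]]; exists b.+1.
apply: (@exact_seq_fin_res (opp A) _ _ _ _ (cores_exact_seq D)) => [m|m bm].
  exact: coresP.
by apply/opp_is_zero/zD; rewrite ltrN2.
Qed.

End Dimensions.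

Section Syzygies.
Variables (A : abelianCat) (W V : A -> Prop).
Hypothesis subW : subcategory W.

(** The hypothesis on relative Ext speaks of proper resolutions. A bounded one exists, and its
    length bounds that of its first syzygy by [n]; degree 1 then extends maps from this syzygy. *)
Lemma relExtl_syzygy_extend :
  (forall n C T, W C -> fin_res W n T -> ext1_zero C T) ->
  (forall T v, pd_finite W T -> V v ->
    forall C : proper_resolution W T, zmod_zero (relExtl C v 1)) ->
  forall n T, fin_res W n.+1 T ->
  exists K c (k : hom K c) (p : hom c T), [/\ is_ses k p, W c, fin_res W n K
    & forall v (f : hom K v), V v -> exists g, g \o k = f].
Proof.
move=> perpW E n T fT; have [C zC] := ex_bounded_proper_resolution subW perpW fT.
apply: (exact_seq_syzygy_extend (res_exact_seq C)) => [m|m nm|v f Vv fd].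
- exact: resP.
- exact: zC.
have pdT : pd_finite W T.
  by exists n, C => -[m|m] // nm; apply: zC.
have := (zhomology_zeroP _ _).1 (E T v pdT Vv C) f.
case=> [|i [y yf]]; first by apply/zcyc_hom_from/(cocyc_res (m := 1)).
have /(cobnd_res (m := 1)) [w [_ wf]] : cobnd f by exists (- i), y.
by exists w.
Qed.

End Syzygies.

Lemma opp_subcategory (A : abelianCat) (P : A -> Prop) :
  subcategory P -> @subcategory (opp A) P.
Proof.
move=> [iP zP bP]; split=> //.
  by move=> a b [f [g [gf fg]]]; apply: iP; exists g, f.
move=> a b s i1 i2 p1 p2 [e11 e22 e12 e21 e]; apply: (bP a b s p1 p2 i1 i2).
by split.
Qed.

(** Not an instance of the previous lemma at [opp A]: the vanishing hypothesis concerns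
    coresolutions in [A], so the bounded resolution found in [opp A] is first converted into one. *)
Lemma relExtr_syzygy_extend (A : abelianCat) (W V : A -> Prop) :
  subcategory V ->
  (forall n C T, V C -> @fin_res (opp A) V n T -> @ext1_zero (opp A) C T) ->
  (forall w U, W w -> id_finite V U ->
    forall D : proper_coresolution V U, zmod_zero (relExtr w D 1)) ->
  forall n T, @fin_res (opp A) V n.+1 T ->
  exists (K c : opp A) (k : hom K c) (p : hom c T),
    [/\ is_ses k p, V c, @fin_res (opp A) V n K
      & forall w (f : hom K w), W w -> exists g, g \o k = f].
Proof.
move=> subV perpV E n T fT.
have [R zR] := @ex_bounded_proper_resolution (opp A) V (opp_subcategory subV)
  perpV n.+1 T fT.
pose D := ProperCoresolution (@opp_proper_resolution _ _ _ R).
have zD m : (n < m)%N -> is_zero (D (- Posz m)).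
  by case: m => [|m] // nm; have [z1 z2] := zR m.+1 nm; split.
apply: (@exact_seq_syzygy_extend (opp A) _ _ V W n (cores_exact_seq D)).
- by move=> m; apply: coresP.
- by move=> m nm; apply/opp_is_zero/zD.
move=> w f Ww fd.
have idT : id_finite V T.
  exists n, D => -[m|m].
    by rewrite ltNge => /negP[]; apply: (@le_trans _ _ 0); rewrite ?oppr_le0.
  by rewrite NegzE ltrN2 => nm; apply: (zD m.+1).
have := (zhomology_zeroP _ _).1 (E w T Ww idT D) f.
case=> [|i [y yf]]; first exact/(zcyc_cores (D := D) (m := 1)).
have : @zbnd (@hom_to A w D) (- Posz 1) f by exists i, y.
move=> /(zbnd_cores (m := 1)) [v [_ vf]].
by exists v.
Qed.

Lemma opp_ext_closed (A : abelianCat) (P : A -> Prop) :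
  ext_closed P -> @ext_closed (opp A) P.
Proof.
move=> eP a b c i p /(@opp_ses (opp A)) s Pa Pc; exact: eP s Pc Pa.
Qed.

Lemma opp_perp (A : abelianCat) (P Q : A -> Prop) :
  perp P Q -> @perp (opp A) Q P.
Proof. by move=> PQ C D QC PD n; apply: ext_zero_opp; apply: PQ. Qed.

Lemma generator_opp (A : abelianCat) (V Y : A -> Prop) :
  generator V Y -> @cogenerator (opp A) V Y.
Proof.
move=> [VY gV]; split=> // a /gV [a' [v [i [p [s Vv Ya']]]]].
by exists v, a', p, i; split=> //; apply: opp_ses.
Qed.

Lemma cogenerator_opp (A : abelianCat) (W X : A -> Prop) :
  cogenerator W X -> @generator (opp A) W X.
Proof.
move=> [WX gW]; split=> // a /gW [w [a' [i [p [s Ww Xa']]]]].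
by exists a', w, p, i; split=> //; apply: opp_ses.
Qed.

Theorem mainTheorem1 (A : abelianCat) (X Y W V : A -> Prop)
  (subX : subcategory X) (subY : subcategory Y)
  (subW : subcategory W) (subV : subcategory V)
  (WX : subclass W X) (VY : subclass V Y)
  (extX : ext_closed X) (extY : ext_closed Y)
  (cogW : injective_cogenerator W X) (genV : projective_generator V Y)
  (perpWY : perp W Y) (perpXV : perp X V)
  (ExtWA0 : forall n : int, 1 <= n -> forall T V0 : A,
     pd_finite W T -> V V0 ->
     forall C : proper_resolution W T, zmod_zero (relExtl C V0 n))
  (ExtAV0 : forall n : int, 1 <= n -> forall W0 U : A,
     W W0 -> id_finite V U ->
     forall D : proper_coresolution V U, zmod_zero (relExtr W0 D n))
  (M N : A) (pdM : pd_finite X M) (idN : id_finite Y N) :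
  [/\ inhabited (proper_resolution X M),
      inhabited (proper_coresolution Y N)
    & forall (C : proper_resolution X M) (D : proper_coresolution Y N)
             (n : int),
        zmod_iso (relExtl C N n) (relExtr M D n)].
Proof.
case: cogW genV => cogW' perpXW [genV' perpVY].
have XW n C T : X C -> fin_res W n T -> ext1_zero C T.
  exact: ext1_zero_fin_res perpXW subW.
(* In [opp A] the classes [Y] and [V] take the places of [X] and [W], and perpendicularity is
   reversed. *)
have YV n (C T : opp A) : Y C -> @fin_res (opp A) V n T ->
    @ext1_zero (opp A) C T.
  exact: (@ext1_zero_fin_res (opp A) _ _ _ _ _ (opp_perp perpVY)
    (opp_subcategory subV)).
have syzW := relExtl_syzygy_extend subW (fun n C T WC => XW n C T (WX C WC))
  (ExtWA0 1 (lexx _)).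
have syzV := relExtr_syzygy_extend subV (fun n C T VC => YV n C T (VY C VC))
  (ExtAV0 1 (lexx _)).
have WY C D : W C -> Y D -> ext1_zero C D.
  by move=> WC YD; apply/ext_zero_ext1/perpWY.
have VX (C D : opp A) : V C -> X D -> @ext1_zero (opp A) C D.
  by move=> VC XD; apply/ext1_zero_opp/ext_zero_ext1/perpXV.
have [m fM] := pd_finite_fin_res pdM.
have [n fN] := id_finite_fin_res idN.
split.
- apply: (@ex_proper_resolution_closed A X subX (fun T => exists n, fin_res X n T))
    => //; last by exists m.
  move=> T [l fT].
  have [K [c [k [p [s Xc pp [l' fK] _]]]]] :=
    fin_res_precover subX subW cogW' extX genV' XW WY syzW fT.
  exists K, c, k, p; split=> //; exists l'.
  exact: fin_res_sub WX fK.
- suff [R] : inhabited (@proper_resolution (opp A) Y N).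
    exact: inhabits (ProperCoresolution (@opp_proper_resolution _ _ _ R)).
  apply: (@ex_proper_resolution_closed (opp A) Y (opp_subcategory subY)
    (fun T => exists n, @fin_res (opp A) Y n T)) => //; last by exists n.
  move=> T [l fT].
  have [K [c [k [p [s Yc pp [l' fK] _]]]]] :=
    @fin_res_precover (opp A) Y X V W (opp_subcategory subY)
      (opp_subcategory subV) (generator_opp genV') (opp_ext_closed extY)
      (cogenerator_opp cogW') YV VX syzV l T fT.
  exists K, c, k, p; split=> //; exists l'.
  exact: (@fin_res_sub (opp A) _ _ _ _ VY fK).
move=> C D q; apply: zmod_iso_zhomology; apply: subquot_rel_hom_from.
(* In negative degrees both sides are subquotients of zero groups. *)
case: q => [q|q]; last first.
  apply: subquot_rel_zero.
  - by move=> f; apply: (@res_neg _ _ _ C (Negz q) _).2.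
  - by move=> f; apply: (@cores_pos _ _ _ D (- Negz q) _).1.
  - by move=> k; rewrite comp0m.
  - by exists 0, 0; rewrite comp0m.
  - by move=> k; rewrite raddf0.
  by exists 0, 0; rewrite raddf0.
have -> : @cocyc _ C N (Posz q) = fun x => x \o res_diff C q.+1 = 0.
  by apply/funext => x; apply/propext/cocyc_res.
have -> : @cobnd _ C N (Posz q) =
    fun x => exists w : hom (res_ob C q) N,
      (q = 0%N -> w = 0) /\ w \o res_diff C q = x.
  by apply/funext => x; apply/propext/cobnd_res.
have -> : @zcyc (hom_to M D) (- Posz q) = fun y => cores_diff D q.+1 \o y = 0.
  by apply/funext => x; apply/propext/zcyc_cores.
have -> : @zbnd (hom_to M D) (- Posz q) = fun y => exists w : hom M (cores_ob D q),
    (q = 0%N -> w = 0) /\ cores_diff D q \o w = y.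
  by apply/funext => x; apply/propext/zbnd_cores.
have [e0 exC] := res_exact_seq C; have [e0' exD] := cores_exact_seq D.
have rM : fin_res_retract X M by exists m, M, (idm M), (idm M); rewrite comp1m.
have rN : @fin_res_retract (opp A) Y N.
  by exists n, N, (@idm (opp A) N), (@idm (opp A) N); rewrite comp1m.
apply: (@balance A (res_ob C) (cores_ob D) (res_diff C) (cores_diff D)).
- by move=> l; apply: exact_at0.
- by move=> l; exact: (@exact_at0 (opp A) _ _ _ _ _ (exD l)).
- by move=> j f; apply: ((epi0P _).1 e0).
(* Rows: the terms of [D] lie in [Y], so maps into them extend along the proper resolution [C]. *)
- move=> j l f fd.
  apply: (proper_res_hom_exact subX subW cogW' extX genV' XW WY syzW
    (res_exact_seq C) _ _ rM _ fd) => [i|K XK|]; [exact: resP| |exact: coresP].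
  exact/res_properP/presP.
- by move=> i f; apply: ((@epi0P (opp A) _ _ _).1 e0').
(* Columns: the same result in [opp A], with [X] and [Y] exchanged, as well as [W] and [V]. *)
move=> i l f fd.
apply: (@proper_res_hom_exact (opp A) Y X V W (opp_subcategory subY)
  (opp_subcategory subV) (generator_opp genV') (opp_ext_closed extY)
  (cogenerator_opp cogW') YV VX syzV _ _ (cores_exact_seq D) _ _ rN _ _ _ _ fd)
  => [j|K YK|]; [exact: coresP| |exact: resP].
exact/cores_properP/pcoresP.
Qed.
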